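(* Let $d\in\mathbb N$. If $T=(T_1,\ldots,T_d)$ is a $d$-variable weighted shift which is a spherical contraction and is balanced, then $T$ admits a spherical dilation.
   Context: $\mathbb Z_+$ is the set of non-negative integers; $\epsilon_j\in\mathbb Z_+^d$ has $j$-th entry $1$ and other entries $0$; $|I|=i_1+\cdots+i_d$ for $I=(i_1,\ldots,i_d)$; $\partial\mathbb B$ is the unit sphere of $\mathbb C^d$. Weighted shift: let $(w_{I,j})_{(I,j)\in\mathbb Z_+^d\times\{1,\ldots,d\}}$ be a bounded collection of complex numbers with $w_{I,j}w_{I+\epsilon_j,k}=w_{I,k}w_{I+\epsilon_k,j}$ for all $I,j,k$. Let $\mathcal H$ be a complex Hilbert space with orthonormal basis $\{e_I:I\in\mathbb Z_+^d\}$. The $d$-variable weighted shift with weights $(w_{I,j})$ is the unique (commuting) $d$-tuple of bounded operators on $\mathcal H$ with $T_je_I=w_{I,j}e_{I+\epsilon_j}$ for all $I,j$. For positive numbers $\{\beta_I\}_{I\in\mathbb Z_+^d}$ with $\beta_0=1$ and $\sup_{I,j}\beta_{I+\epsilon_j}/\beta_I<\infty$, $H^2(\beta)$ is the Hilbert space of formal power series $f(z)=\sum_If_Iz^I$ with $\|f\|_{H^2(\beta)}^2=\sum_I|f_I|^2\beta_I^2<\infty$. For a sequence $\gamma=\{\gamma_k\}_{k\in\mathbb Z_+}$ of positive numbers, $H^2(\gamma)$ is the Hilbert space of formal power series $\sum_ka_kt^k$ in one variable with squared norm $\sum_k|a_k|^2\gamma_k^2<\infty$. For $z\in\mathbb C^d$,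 the slice of $f$ at $z$ is the formal power series $f_z(t)=\sum_{k\in\mathbb Z_+}\big(\sum_{|I|=k}f_Iz^I\big)t^k$. A Reinhardt measure is a Borel probability measure supported in $\partial\mathbb B$ and invariant under the coordinatewise action of $\mathbb T^d=\{z\in\mathbb C^d:|z_1|=\cdots=|z_d|=1\}$. The norm on $H^2(\beta)$ admits the slice representation $[\mu,H^2(\gamma)]$ if $\mu$ is a Reinhardt measure and $\|f\|_{H^2(\beta)}^2=\int_{\partial\mathbb B}\|f_z\|_{H^2(\gamma)}^2\,d\mu(z)$ for all $f\in H^2(\beta)$, where $\beta_I=\gamma_{|I|}\|z^I\|_{L^2(\partial\mathbb B,\mu)}$ for all $I\in\mathbb Z_+^d$. A $d$-variable weighted shift $T$ is balanced if, with $\beta_I=\|T^Ie_0\|$ (all assumed positive) for $I\in\mathbb Z_+^d$, the norm on $H^2(\beta)$ admits a slice representation $[\mu,H^2(\gamma)]$ for some $\mu$ and $\gamma$. A commuting $d$-tuple $T$ is a spherical contraction if $\sum_{j=1}^dT_j^*T_j\le I$. A commuting $d$-tuple $U$ of bounded operators is a spherical unitary if each $U_j$ is normal and $\sum_jU_j^*U_j=I$. A commuting $d$-tuple $T$ in $\mathcal B(\mathcal H)$ admits a spherical dilation if there exist a Hilbert space $\mathcal K\supset\mathcal H$ and a spherical unitary $U$ in $\mathcal B(\mathcal K)$ such that $T^I=P_{\mathcal H}U^I|_{\mathcal H}$ for all $I\in\mathbb Z_+^d$, where $P_{\mathcal H}$ is the orthogonal projection of $\mathcal K$ onto $\mathcal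 H$. *)

(* Defs.v *)
From HB Require Import structures.
From mathcomp Require Import all_boot all_order all_algebra.
From mathcomp Require Import sesquilinear.
From mathcomp Require Import all_classical all_reals all_analysis.
From mathcomp.real_closed Require Import complex.

Set Implicit Arguments.
Unset Strict Implicit.
Unset Printing Implicit Defensive.

Import Order.TTheory GRing.Theory Num.Theory Num.Def.
Import numFieldNormedType.Exports Normc.

Local Open Scope classical_set_scope.
Local Open Scope ring_scope.
Local Open Scope complex_scope.

(** * Hilbert spaces and operators *)

(* The norm of a normed module over [R[i]] takes its values in the
   nonnegative elements of [R[i]], hence the absence of casts below.
   Following the library convention for [{dot _ for _}], the inner product is
   linear in the first argument and conjugate-linear in the second. *)
HB.mixin Record CompleteNormedModule_isHilbert (R : realType) H
    & CompleteNormedModule R[i] H := {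
  hdot : {dot H for (@conjC R[i])} ;
  hdot_norm : forall x : H, `|x| ^+ 2 = hdot x x
}.

#[short(type="hilbertType")]
HB.structure Definition Hilbert (R : realType) :=
  {H of CompleteNormedModule R[i] H & CompleteNormedModule_isHilbert R H}.

Section Operators.
Variables (R : realType) (H : hilbertType R).
Implicit Types A B : H -> H.

Definition is_adjoint A B : Prop :=
  forall x y, hdot (A x) y = hdot x (B y).

Definition op_le A B : Prop := forall x, hdot (A x) x <= hdot (B x) x.

Definition normal_op A : Prop :=
  exists2 B, is_adjoint A B & A \o B =1 B \o A.

Definition orthogonal_projection (P : H -> H) (M : set H) : Prop :=
  forall y, M (P y) /\ forall m, M m -> hdot (y - P y) m = 0.

Definition orthonormal_basis (I : choiceType) (e : I -> H) : Prop :=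
  (forall i j, hdot (e i) (e j) = (i == j)%:R) /\
  closure [set x | exists (s : seq I) (c : I -> R[i]),
                     x = \sum_(i <- s) c i *: e i] = setT.

End Operators.

(** * Multi-indices and tuples of operators *)

Notation multi_index d := {ffun 'I_d -> nat}.

Definition eps d (j : 'I_d) : multi_index d := [ffun k => (k == j) : nat].

Definition mi_deg d (I : multi_index d) : nat := (\sum_(j < d) I j)%N.

Section Tuples.
Variables (R : realType) (d : nat) (H : hilbertType R).
Implicit Type T : 'I_d -> {linear H -> H}.

Definition tuple_pow T (I : multi_index d) : H -> H :=
  \big[(fun f g => f \o g)/idfun]_(j < d) iter (I j) (T j).

Definition bounded_tuple T : Prop :=
  forall j, bounded_near (T j) (nbhs (0 : H)).

Definition commuting_tuple T : Prop :=
  forall j k, T j \o T k =1 T k \o T j.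

(* In the next two definitions [S j] is the adjoint of [T j]; for a bounded
   [T j] it exists, by Riesz representation, and it is unique. *)
Definition spherical_contraction T : Prop :=
  commuting_tuple T /\
  exists2 S : 'I_d -> H -> H, (forall j, is_adjoint (T j) (S j)) &
    op_le (fun x => \sum_(j < d) S j (T j x)) idfun.

Definition spherical_unitary T : Prop :=
  [/\ bounded_tuple T, commuting_tuple T, (forall j, normal_op (T j)) &
      exists2 S : 'I_d -> H -> H, (forall j, is_adjoint (T j) (S j)) &
        (fun x => \sum_(j < d) S j (T j x)) =1 idfun].

Definition shift_weights (w : multi_index d -> 'I_d -> R[i]) : Prop :=
  (exists M : R, forall I j, `|w I j| <= M%:C) /\
  forall I j k, w I j * w (I + eps j) k = w I k * w (I + eps k) j.

Definition weighted_shift (e : multi_index d -> H)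
    (w : multi_index d -> 'I_d -> R[i]) T : Prop :=
  [/\ orthonormal_basis e, shift_weights w, bounded_tuple T &
      forall I j, T j (e I) = w I j *: e (I + eps j)].

End Tuples.

(* The inclusion of [H] in [K] is an isometric embedding [V], and [P] is the
   orthogonal projection of [K] onto the image of [H]. *)
Definition admits_spherical_dilation (R : realType) (d : nat)
    (H : hilbertType R) (T : 'I_d -> {linear H -> H}) : Prop :=
  exists (K : hilbertType R) (V : {linear H -> K}) (P : K -> K)
         (U : 'I_d -> {linear K -> K}),
    [/\ forall x y, hdot (V x) (V y) = hdot x y,
        orthogonal_projection P (range V),
        spherical_unitary U &
        forall (I : multi_index d) (x : H),
          V (tuple_pow T I x) = P (tuple_pow U I (V x))].

(** * Slice representations *)

Section Slices.
Variables (R : realType) (d : nat).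

(* [C^d] with its Borel sigma-algebra; [R[i]^o] is [R[i]] with the topology
   given by its norm. *)
Local Notation Cvec := 'rV[R[i]^o]_d.

Definition borelC := g_sigma_algebraType (@open Cvec).

Definition sphere : set borelC :=
  [set z : Cvec | \sum_(j < d) `|z 0 j| ^+ 2 = 1 :> R[i]].

Definition torus : set Cvec := [set z | forall j, `|z 0 j| = 1 :> R[i]].

Definition cmul (u z : Cvec) : Cvec := \row_j (u 0 j * z 0 j).

Definition monomial (I : multi_index d) (z : Cvec) : R[i] :=
  \prod_(j < d) (z 0 j : R[i]) ^+ I j.

Definition reinhardt (mu : probability borelC R) : Prop :=
  mu (~` sphere) = 0%E /\
  forall u, torus u -> forall A : set borelC, measurable A ->
    mu (cmul u @^-1` A) = mu A.

(* Formal power series in [d] variables, resp. in one variable, are given by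
   their coefficients [multi_index d -> R[i]], resp. [nat -> R[i]]; [sqnorm]
   and [sqnorm1] are the squared norms of H^2(beta) and H^2(gamma), with value
   [+oo] outside of these spaces. *)
Definition sqnorm (beta : multi_index d -> R) (f : multi_index d -> R[i])
    : \bar R :=
  (\esum_(I in [set: multi_index d]) ((normc (f I)) ^+ 2 * beta I ^+ 2)%:E)%E.

Definition sqnorm1 (gamma : nat -> R) (a : nat -> R[i]) : \bar R :=
  (\sum_(0 <= k <oo) ((normc (a k)) ^+ 2 * gamma k ^+ 2)%:E)%E.

Definition in_H2 (beta : multi_index d -> R) (f : multi_index d -> R[i])
    : Prop := (sqnorm beta f < +oo)%E.

Definition slice (f : multi_index d -> R[i]) (z : Cvec) (k : nat) : R[i] :=
  \sum_(I \in [set I : multi_index d | mi_deg I = k]) f I * monomial I z.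

(* As [mu] vanishes off the sphere, the norm of L^2(mu) taken over the whole
   space is that of L^2(sphere, mu). *)
Definition slice_representation (beta : multi_index d -> R)
    (mu : probability borelC R) (gamma : nat -> R) : Prop :=
  [/\ reinhardt mu,
      forall k, 0 < gamma k,
      forall I, (beta I)%:E =
        ((gamma (mi_deg I))%:E *
         'N[mu]_2%:E[(fun z : borelC => (normc (monomial I z))%:E)])%E &
      forall f, in_H2 beta f ->
        sqnorm beta f =
        (\int[mu]_(z in sphere) sqnorm1 gamma (slice f z))%E].

End Slices.

Section Balanced.
Variables (R : realType) (d : nat) (H : hilbertType R).

Definition shift_beta (e : multi_index d -> H) (T : 'I_d -> {linear H -> H})
    (I : multi_index d) : R := complex.Re `|tuple_pow T I (e 0)|.

(* For a weighted shift with weights [w], [beta = shift_beta e T] satisfies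
   [beta 0 = 1] and [beta (I + eps j) = `|w I j| * beta I], so that the
   normalization of [beta] and the boundedness of the ratios
   [beta (I + eps j) / beta I], required to form H^2(beta), are automatic. *)
Definition balanced (e : multi_index d -> H) (T : 'I_d -> {linear H -> H})
    : Prop :=
  (forall I, 0 < shift_beta e T I) /\
  exists (mu : probability (borelC R d) R) (gamma : nat -> R),
    slice_representation (shift_beta e T) mu gamma.

End Balanced.

(* Main.v *)
Require Import Defs.
From HB Require Import structures.
From mathcomp Require Import all_boot all_order all_algebra.
From mathcomp Require Import sesquilinear.
From mathcomp Require Import all_classical all_reals all_analysis.
From mathcomp.real_closed Require Import complex.
From mathcomp Require Import measurable_realfun ring.

(** A slice representation [mu, H^2(gamma)] turns a power series into a function
    of a point [z] of the sphere with values in [H^2(gamma)], and in this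
    picture the weighted shift multiplies by [z_j] in the first variable and
    shifts the degree in the second one. Multiplication by the coordinates is
    already a spherical unitary on [L^2(mu)], so that only the one-variable
    shift with weights [gamma_(k+1) / gamma_k] has to be dilated.

    Since [sum_j |z_j|^2 = 1] on the sphere, the squared norms in [L^2(mu)] of
    the monomials [z^(I + eps_j)] add up to that of [z^I]; testing the spherical
    contraction on the basis vector [e_I] thus gives [gamma_(k+1) <= gamma_k]
    ([gamma_noninc]). For such a sequence the unit vectors
    [c_k = gamma_k^-1 1_[0, gamma_k^2]] of [L^2[0, 1]] (when [gamma_0 = 1])
    satisfy [<c_k, c_l> = gamma_l / gamma_k] for [k <= l], which is the matrix
    coefficient of the power [l - k] of the one-variable shift. No operator has
    to act on this second factor: the invariance of [mu] under the torus makes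
    monomials with different exponents orthogonal ([monomial_orthogonal]), hence
    the degree is already recorded in the first factor.

    So the dilation space is [K = L^2(sphere x [0, 1], mu x Lebesgue)], with
    [U_j] the multiplication by [z_j]. If [T^J e_0 = W_J e_J], the vectors
    [f_J = (gamma_0 / W_J) z^J 1_[0, (gamma_|J| / gamma_0)^2]] are orthonormal
    and [<U^I f_J, f_L> = <T^I e_J, e_L>] for all [I], [J], [L]. This makes the
    isometry [e_J |-> f_J] a dilation ([spherical_dilation_criterion]), because
    a bounded operator is determined by its matrix in an orthonormal basis.

    The space [K] is obtained as the completion of the bounded measurable
    functions for the semi-inner product [int f g^*]. *)

Set Implicit Arguments.
Unset Strict Implicit.
Unset Printing Implicit Defensive.

Import Order.TTheory GRing.Theory Num.Theory Num.Def.
Import numFieldNormedType.Exports Normc.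

Local Open Scope classical_set_scope.
Local Open Scope ring_scope.
Local Open Scope complex_scope.

Local Notation Re := complex.Re.
Local Notation Im := complex.Im.

(** * Limits of complex sequences *)

Lemma cauchy_seq_cvg (K : numFieldType) (V : completeNormedModType K)
    (u : nat -> V) : (forall e : K, 0 < e ->
  exists N, forall m n, (N <= m)%N -> (N <= n)%N -> `|u m - u n| < e) ->
  cvgn u.
Proof.
move=> hu; apply/cauchy_cvgP/cauchy_ballP => e /hu[N hN].
exists (u @` [set n | (N <= n)%N], u @` [set n | (N <= n)%N]) => /=.
  by split; exists N => // n hn; exists n.
by move=> _ /= [[m hm <-] [n hn <-]]; rewrite -ball_normE /= hN.
Qed.

Section ComplexLimits.
Variable R : realType.
Local Notation C := R[i].

Lemma conjcE (z : C) : conjC z = conjc z. Proof. by []. Qed.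

Lemma ler_norm_ReIm (z : C) : `|z| <= (`|Re z| + `|Im z|)%:C.
Proof.
rewrite [in leLHS](complexE z) (le_trans (ler_normD _ _)) // rmorphD /= normrM.
have -> : `|'i : C| = 1 by rewrite normc_def /= expr0n expr1n add0r sqrtr1.
by rewrite mul1r !normc_def /= !expr0n /= !addr0 !sqrtr_sqr.
Qed.

Lemma normc_ge_Im (z : C) : (`|Im z|)%:C <= `|z|.
Proof. by rewrite normc_def lecR -sqrtr_sqr ler_wsqrtr // lerDr sqr_ge0. Qed.

(** The order of [R[i]] is partial: a positive element is a real number. *)
Lemma gt0_complex (e : C) : 0 < e -> 0 < Re e /\ e = (Re e)%:C.
Proof.
move=> e0; have := e0; rewrite ltcE => /andP[_ /= ->]; split=> //.
by rewrite RRe_real // gtr0_real.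
Qed.

Lemma archi_invC (e : C) : 0 < e -> exists n, n.+1%:R^-1 < e.
Proof.
move=> /gt0_complex[e0 ->]; have [n hn] := ltr_add_invr e0.
exists n; rewrite add0r in hn; move: hn; rewrite -ltcR; congr (_ < _).
by rewrite fmorphV rmorph_nat.
Qed.

Definition cauchyC (u : nat -> C) := forall e : C, 0 < e ->
  exists N, forall m n, (N <= m)%N -> (N <= n)%N -> `|u m - u n| < e.

Lemma cauchyC_cvg (u : nat -> C) : cauchyC u ->
  exists l : C, u @ \oo --> (l : C^o).
Proof.
move=> hu.
have h (f : C -> R) : (forall x y, f (x - y) = f x - f y) ->
    (forall x, (`|f x|)%:C <= `|x|) -> cvgn (f \o u).
  move=> fB fn; apply: (@cauchy_seq_cvg R R) => e e0.
  have [|N hN] := hu e%:C; first by rewrite ltcR.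
  exists N => m n hm hn; rewrite /= -fB -ltcR.
  exact: le_lt_trans (fn _) (hN _ _ hm hn).
have /cvg_ex[/= a ca] : cvgn (@complex.Re R \o u).
  by apply: h => [[? ?] [? ?]|x] //; exact: normc_ge_Re.
have /cvg_ex[/= b cb] : cvgn (@complex.Im R \o u).
  by apply: h => [[? ?] [? ?]|x] //; exact: normc_ge_Im.
exists (a +i* b); apply/(@cvgrPdist_lt _ C^o) => e /gt0_complex[e0 ->].
have e2 : 0 < Re e / 2 by rewrite divr_gt0.
move/cvgrPdist_lt : ca => /(_ _ e2) ca; move/cvgrPdist_lt : cb => /(_ _ e2) cb.
near=> n; apply: le_lt_trans (ler_norm_ReIm _) _; rewrite ltcR.
rewrite [ltRHS](splitr (Re e)); apply: ltrD.
  have : `|a - Re (u n)| < Re e / 2 by near: n.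
  by case: (u n).
have : `|b - Im (u n)| < Re e / 2 by near: n.
by case: (u n).
Unshelve. all: by end_near. Qed.

Lemma cvg_conj (u : nat -> C) (l : C) :
  u @ \oo --> (l : C^o) -> (fun n => conjC (u n)) @ \oo --> (conjC l : C^o).
Proof.
move/(@cvgrPdist_lt _ C^o) => h; apply/(@cvgrPdist_lt _ C^o) => e /h.
by apply: filterS => n; rewrite -rmorphB norm_conjC.
Qed.

Lemma cvgC_unique (u : nat -> C) (a b : C) :
  u @ \oo --> (a : C^o) -> u @ \oo --> (b : C^o) -> a = b.
Proof. by move=> ha hb; exact: (@cvg_unique _ (@norm_hausdorff _ C^o) _ _ _ _
  ha hb). Qed.

Lemma cvgC_norm (u : nat -> C) (l : C) :
  u @ \oo --> (l : C^o) -> (fun n => `|u n|) @ \oo --> (`|l| : C^o).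
Proof.
move/(@cvgrPdist_lt _ C^o) => h; apply/(@cvgrPdist_lt _ C^o) => e /h.
by apply: filterS => n; apply: le_lt_trans; exact: ler_dist_dist.
Qed.

Lemma cvgC_ge0 (u : nat -> C) (l : C) :
  (forall n, 0 <= u n) -> u @ \oo --> (l : C^o) -> 0 <= l.
Proof.
move=> u0 hu; suff -> : l = `|l| by exact: normr_ge0.
apply: (cvgC_unique hu); have := cvgC_norm hu.
suff -> : (fun n => `|u n|) = u by [].
by apply/funext => n; rewrite ger0_norm.
Qed.

Lemma cvgC_cst (l : C) : ((fun=> l) : nat -> C) @ \oo --> (l : C^o).
Proof. exact: (@cvg_cst C^o). Qed.

Lemma cvgC_lin (c a b : C) (u v : nat -> C) :
  u @ \oo --> (a : C^o) -> v @ \oo --> (b : C^o) ->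
  (fun n => c * u n + v n) @ \oo --> (c * a + b : C^o).
Proof.
by move=> hu hv; exact: (@cvgD _ C^o _ _ _ _ _ _ _ (@cvgMl_tmp C _ _ _ _ c _
  hu) hv).
Qed.

End ComplexLimits.

(** * Semi-inner products *)

Section Semidot.
Variables (R : realType) (E : lmodType R[i]).
Local Notation C := R[i].

(** Possibly degenerate: functions that vanish almost everywhere are null
    vectors of the intended example. *)
Record semidot := Semidot {
  sdot :> E -> E -> C;
  sdotPl : forall a x y z, sdot (a *: x + y) z = a * sdot x z + sdot y z;
  sdotC : forall x y, sdot y x = conjC (sdot x y);
  sdot_ge0 : forall x, 0 <= sdot x x }.

Variable q : semidot.
Implicit Types (x y z : E) (a b : C).

Lemma sdotDl x y z : q (x + y) z = q x z + q y z.
Proof. by rewrite -{1}(scale1r x) sdotPl mul1r. Qed.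
Lemma sdot0l z : q 0 z = 0.
Proof. by apply/(addrI (q 0 z)); rewrite -sdotDl !addr0. Qed.
Lemma sdotZl a x z : q (a *: x) z = a * q x z.
Proof. by rewrite -[a *: x]addr0 sdotPl sdot0l addr0. Qed.
Lemma sdotNl x z : q (- x) z = - q x z.
Proof. by rewrite -scaleN1r sdotZl mulN1r. Qed.
Lemma sdotBl x y z : q (x - y) z = q x z - q y z.
Proof. by rewrite sdotDl sdotNl. Qed.
Lemma sdotDr x y z : q z (x + y) = q z x + q z y.
Proof. by rewrite sdotC sdotDl rmorphD /= -!sdotC. Qed.
Lemma sdotZr a x z : q z (a *: x) = conjC a * q z x.
Proof. by rewrite sdotC sdotZl rmorphM /= -sdotC. Qed.
Lemma sdotNr x z : q z (- x) = - q z x.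
Proof. by rewrite sdotC sdotNl rmorphN /= -sdotC. Qed.
Lemma sdotBr x y z : q z (x - y) = q z x - q z y.
Proof. by rewrite sdotDr sdotNr. Qed.
Definition snorm x : C := sqrtC (q x x).

Lemma snorm_ge0 x : 0 <= snorm x.
Proof. by rewrite sqrtC_ge0 sdot_ge0. Qed.

Lemma snorm_sqr x : snorm x ^+ 2 = q x x.
Proof. by rewrite sqrtCK. Qed.

Lemma snormZ a x : snorm (a *: x) = `|a| * snorm x.
Proof.
rewrite /snorm sdotZl sdotZr mulrA -normCK sqrtCM ?nnegrE ?exprn_ge0 ?sdot_ge0
  //.
by rewrite sqrCK.
Qed.

Lemma sdot_sub_scale a x y :
  q (x - a *: y) (x - a *: y) =
  q x x - (a * conjC (q x y) + conjC a * q x y) + `|a| ^+ 2 * q y y.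
Proof.
rewrite !sdotBl !sdotBr !sdotZl !sdotZr (sdotC q x y) normCK; ring.
Qed.

(** If [q y y] is nonzero, subtract from [x] its projection on [y]; if both
    [x] and [y] are null vectors, test positivity on [x - q x y *: y]. *)
Lemma semi_Cauchy_Schwarz x y : `|q x y| <= snorm x * snorm y.
Proof.
suff: `|q x y| ^+ 2 <= q x x * q y y.
  rewrite -!snorm_sqr -exprMn ler_pXn2r ?nnegrE ?normr_ge0 ?mulr_ge0 ?snorm_ge0
    //.
have main u v : q v v != 0 -> `|q u v| ^+ 2 <= q u u * q v v.
  move=> v0; have := sdot_ge0 q (u - (q u v / q v v) *: v).
  rewrite sdot_sub_scale.
  have cv : conjC (q v v) = q v v by rewrite -sdotC.
  rewrite rmorphM /= fmorphV /= cv normrM exprMn normfV.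
  rewrite (ger0_norm (sdot_ge0 q v)) normCK.
  set X := (X in 0 <= X).
  have -> : X = q u u - q u v * conjC (q u v) / q v v by rewrite /X; field.
  rewrite subr_ge0 ler_pdivrMr //.
  by rewrite lt_def v0 sdot_ge0.
have [y0|] := eqVneq (q y y) 0; last exact: main.
have [x0|] := eqVneq (q x x) 0; last first.
  by move=> /(main y x); rewrite (sdotC q x y) norm_conjC mulrC.
have := sdot_ge0 q (x - q x y *: y).
rewrite sdot_sub_scale x0 y0 mulr0 addr0 sub0r mul0r [conjC _ * _]mulrC -normCK.
by rewrite -mulr2n oppr_ge0 pmulrn_lle0.
Qed.

Lemma snormD x y : snorm (x + y) <= snorm x + snorm y.
Proof.
rewrite -(@ler_pXn2r _ 2) ?nnegrE ?addr_ge0 ?snorm_ge0 //.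
rewrite snorm_sqr sqrrD !snorm_sqr !sdotDl !sdotDr (sdotC q x y).
have : q x y + conjC (q x y) <= (snorm x * snorm y) *+ 2.
  apply: le_trans (real_ler_norm _) _.
    by rewrite CrealE rmorphD /= conjCK addrC.
  apply: le_trans (ler_normD _ _) _; rewrite norm_conjC -mulr2n lerMn2r /=.
  exact: semi_Cauchy_Schwarz.
by move=> h; rewrite -!addrA lerD2l !addrA lerD2r.
Qed.

End Semidot.
(** * Completion of a semi-inner product space *)

Section CauchySequences.
Variables (R : realType) (E : lmodType R[i]) (q : semidot E).
Local Notation C := R[i].
Local Notation N := (snorm q).
Implicit Types x y z : nat -> E.

Definition scauchy x := forall e : C, 0 < e ->
  exists k, forall m n, (k <= m)%N -> (k <= n)%N -> N (x m - x n) < e.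

Lemma scauchy_cst (v : E) : scauchy (fun=> v).
Proof.
by move=> e e0; exists 0%N => m n _ _; rewrite subrr /snorm sdot0l sqrtC0.
Qed.

Lemma scauchyP (a : C) x y : scauchy x -> scauchy y ->
  scauchy (fun n => a *: x n + y n).
Proof.
move=> hx hy e e0; have a0 : 0 < `|a| + 1 by rewrite ltr_wpDl.
have [|k hk] := hx (e / 2 / (`|a| + 1)); first by rewrite !divr_gt0.
have [|l hl] := hy (e / 2); first by rewrite divr_gt0.
exists (maxn k l) => m n; rewrite !geq_max => /andP[km lm] /andP[kn ln].
rewrite opprD addrACA -scalerBr (le_lt_trans (snormD _ _ _)) //.
rewrite [ltRHS](splitr e) ler_ltD ?hl // snormZ.
have := hk _ _ km kn; rewrite ltr_pdivlMr // mulrDr mulr1 => /ltW.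
apply: le_trans; rewrite mulrC lerDl; exact: snorm_ge0.
Qed.

Lemma scauchyB x y : scauchy x -> scauchy y -> scauchy (fun n => x n - y n).
Proof.
move=> hx hy; have := scauchyP (-1) hy hx.
by congr scauchy; apply/funext => n; rewrite scaleN1r addrC.
Qed.

Lemma scauchy_bound x : scauchy x ->
  exists2 B : C, 0 < B & exists k, forall n, (k <= n)%N -> N (x n) <= B.
Proof.
move=> /(_ 1 ltr01)[k hk]; exists (N (x k) + 1);
  first by rewrite ltr_wpDl ?snorm_ge0.
exists k => n kn; rewrite -[x n](subrK (x k)) (le_trans (snormD _ _ _)) //.
by rewrite addrC lerD2l ltW // hk.
Qed.

Lemma scauchy_dot x y : scauchy x -> scauchy y ->
  cauchyC (fun n => q (x n) (y n)).
Proof.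
move=> hx hy e e0.
have [A A0 [k1 hA]] := scauchy_bound hx; have [B B0 [k2 hB]] := scauchy_bound
  hy.
have [|k3 h3] := hx (e / 2 / B); first by rewrite !divr_gt0.
have [|k4 h4] := hy (e / 2 / A); first by rewrite !divr_gt0.
exists (maxn (maxn k1 k2) (maxn k3 k4)) => m n.
rewrite !geq_max => /andP[/andP[m1 m2] /andP[m3 m4]] /andP[/andP[n1 n2]
  /andP[n3 n4]].
have -> : q (x m) (y m) - q (x n) (y n) =
  q (x m - x n) (y m) + q (x n) (y m - y n).
  by rewrite sdotBl sdotBr subrKA.
rewrite (le_lt_trans (ler_normD _ _)) // [ltRHS](splitr e) ltr_leD //.
  apply: le_lt_trans (semi_Cauchy_Schwarz _ _ _) _.
  apply: (@le_lt_trans _ _ (N (x m - x n) * B)).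
    by rewrite ler_wpM2l ?snorm_ge0 ?hB.
  by rewrite -ltr_pdivlMr // h3.
apply: le_trans (semi_Cauchy_Schwarz _ _ _) _.
apply: (@le_trans _ _ (A * N (y m - y n))).
  by rewrite ler_wpM2r ?snorm_ge0 ?hA.
by rewrite mulrC -ler_pdivlMr // ltW // h4.
Qed.

(** A Cauchy sequence is identified with the functional [v |-> lim q (x n) v].
    Sequences with the same limit give the same functional, so that the
    completion is a space of functionals and no quotient is needed. *)
Definition represents x (phi : E -> C) :=
  scauchy x /\ forall v, (fun n => q (x n) v) @ \oo --> (phi v : C^o).

Lemma scauchy_represents x : scauchy x -> exists phi, represents x phi.
Proof.
move=> hx.
have h v : exists l : C, (fun n => q (x n) v) @ \oo --> (l : C^o).
  exact: cauchyC_cvg (scauchy_dot hx (scauchy_cst v)).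
by exists (fun v => projT1 (cid (h v))); split=> // v;
  exact: projT2 (cid (h v)).
Qed.

(** Split [q (z n) (z n)] as [q (z n) (z n - z k) + q (z n) (z k)]: for [k]
    large the first term is small uniformly in [n], and then the second one
    tends to [0]. *)
Lemma weak_null_strong z : scauchy z ->
  (forall v, (fun n => q (z n) v) @ \oo --> (0 : C^o)) ->
  (fun n => N (z n)) @ \oo --> (0 : C^o).
Proof.
move=> hz wz; have [B B0 [k1 hB]] := scauchy_bound hz.
apply/(@cvgrPdist_lt _ C^o) => e e0.
have e2 : 0 < e ^+ 2 / 2 by rewrite divr_gt0 ?exprn_gt0.
have [|k hk] := hz (e ^+ 2 / 2 / B); first by rewrite divr_gt0.
have /(@cvgrPdist_lt _ C^o)/(_ _ e2) hw := wz (z (maxn k k1)).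
near=> n; rewrite sub0r normrN (ger0_norm (snorm_ge0 _ _)).
rewrite -(@ltr_pXn2r _ 2) ?nnegrE ?snorm_ge0 ?(ltW e0) //.
rewrite snorm_sqr -[ltLHS](ger0_norm (sdot_ge0 _ _)).
rewrite -[X in q _ X](subrK (z (maxn k k1))) sdotDr.
rewrite (le_lt_trans (ler_normD _ _)) // [ltRHS](splitr (e ^+ 2)) ltrD //.
  apply: le_lt_trans (semi_Cauchy_Schwarz _ _ _) _.
  apply: (@le_lt_trans _ _ (B * N (z n - z (maxn k k1)))).
    rewrite ler_wpM2r ?snorm_ge0 // hB //.
    by near: n; exists k1.
  rewrite mulrC -ltr_pdivlMr // hk ?leq_maxl //.
  by near: n; exists k.
rewrite -normrN -sub0r; near: n; exact: hw.
Unshelve. all: by end_near. Qed.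

Lemma null_dot z y : scauchy y -> (fun n => N (z n)) @ \oo --> (0 : C^o) ->
  (fun n => q (z n) (y n)) @ \oo --> (0 : C^o).
Proof.
move=> /scauchy_bound[B B0 [k hB]] hz.
apply/(@cvgrPdist_lt _ C^o) => e e0.
have eB : 0 < e / B by rewrite divr_gt0.
move/(@cvgrPdist_lt _ C^o)/(_ _ eB) : hz => hz.
near=> n; rewrite sub0r normrN.
apply: le_lt_trans (semi_Cauchy_Schwarz _ _ _) _.
apply: (@le_lt_trans _ _ (N (z n) * B)).
  rewrite ler_wpM2l ?snorm_ge0 ?hB //; by near: n; exists k.
rewrite -ltr_pdivlMr // -(ger0_norm (snorm_ge0 _ _)) -normrN -sub0r.
by near: n.
Unshelve. all: by end_near. Qed.

Lemma represents_null x x' phi : represents x phi -> represents x' phi ->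
  (fun n => N (x n - x' n)) @ \oo --> (0 : C^o).
Proof.
move=> [hx cx] [hx' cx']; apply: (@weak_null_strong (fun n => x n - x' n)).
  exact: scauchyB.
move=> v; rewrite -(subrr (phi v)).
have -> : (fun n => q (x n - x' n) v) = (fun n => q (x n) v) - (fun n => q (x'
  n) v).
  by apply/funext => n; rewrite sdotBl.
by apply: (@cvgB _ C^o); [exact: cx|exact: cx'].
Qed.

(** The scalar product of two limits does not depend on the sequences: by
    bilinearity the error is controlled by [x - x'] and [y - y'], which are
    null sequences in norm by [weak_null_strong]. *)
Lemma represents_dot x x' y y' phi psi (l : C) :
  represents x phi -> represents x' phi ->
  represents y psi -> represents y' psi ->
  (fun n => q (x n) (y n)) @ \oo --> (l : C^o) ->
  (fun n => q (x' n) (y' n)) @ \oo --> (l : C^o).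
Proof.
move=> rx rx' ry ry' h.
have h1 : (fun n => q (x n - x' n) (y n)) @ \oo --> (0 : C^o).
  by apply: (@null_dot (fun n => x n - x' n));
    [case: ry|exact: represents_null rx rx'].
have h2 : (fun n => conjC (q (y n - y' n) (x' n))) @ \oo --> (0 : C^o).
  rewrite -(conjC0 C); apply: cvg_conj.
  by apply: (@null_dot (fun n => y n - y' n));
    [case: rx'|exact: represents_null ry ry'].
have e n : q (x' n) (y' n) =
    q (x n) (y n) - q (x n - x' n) (y n) - conjC (q (y n - y' n) (x' n)).
  by rewrite -sdotC sdotBl sdotBr !subKr.
have h3 := @cvgB _ C^o _ _ _ _ _ _ _ (@cvgB _ C^o _ _ _ _ _ _ _ h h1) h2.
rewrite !subr0 in h3; suff -> : (fun n => q (x' n) (y' n)) = (fun n => q (x n)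
  (y n)
    - q (x n - x' n) (y n) - conjC (q (y n - y' n) (x' n))) by exact: h3.
by apply/funext.
Qed.

End CauchySequences.
Section Completion.
Variables (R : realType) (E : lmodType R[i]) (q : semidot E).
Local Notation C := R[i].

Definition representable : {pred E -> C} :=
  fun phi => `[< exists x, represents q x phi >].

Record completion := Completion {
  functional :> E -> C;
  functionalP : functional \in representable }.

HB.instance Definition _ := [isSub for functional].
HB.instance Definition _ := gen_eqMixin completion.
HB.instance Definition _ := gen_choiceMixin completion.

Lemma represents_lin (a : C) x y phi psi :
  represents q x phi -> represents q y psi ->
  represents q (fun n => a *: x n + y n) (fun v => a * phi v + psi v).
Proof.
move=> [hx cx] [hy cy]; split; first exact: scauchyP.
move=> v.
have := @cvgC_lin _ a _ _ _ _ (cx v) (cy v).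
suff -> : (fun n => q (a *: x n + y n) v) = (fun n => a * q (x n) v + q (y n)
  v).
  by [].
by apply/funext => n; rewrite sdotPl.
Qed.

Lemma represents0 : represents q (fun=> 0) (fun=> 0).
Proof.
split; first exact: scauchy_cst.
move=> v; rewrite sdot0l; exact: (@cvgC_cst R 0).
Qed.

Fact representable_submod : submod_closed representable.
Proof.
split.
  by apply/asboolP; exists (fun=> 0); exact: represents0.
move=> a phi psi /asboolP[x hx] /asboolP[y hy]; apply/asboolP.
by exists (fun n => a *: x n + y n); exact: represents_lin.
Qed.

HB.instance Definition _ :=
  GRing.isSubmodClosed.Build C (E -> C) representable representable_submod.
HB.instance Definition _ := [SubChoice_isSubLmodule of completion by <:].

Lemma completion_ext (phi psi : completion) : phi =1 psi -> phi = psi.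
Proof. by move=> h; apply/val_inj/funext. Qed.

Definition crep (phi : completion) : nat -> E :=
  projT1 (cid (asboolW (functionalP phi))).

Lemma crepP (phi : completion) : represents q (crep phi) phi.
Proof. by rewrite /crep; case: cid. Qed.

Lemma cdot_ex (phi psi : completion) : exists l : C,
  (fun n => q (crep phi n) (crep psi n)) @ \oo --> (l : C^o).
Proof.
by apply: cauchyC_cvg; apply: scauchy_dot;
  [case: (crepP phi)|case: (crepP psi)].
Qed.

Definition cdot (phi psi : completion) : C := projT1 (cid (cdot_ex phi psi)).

Lemma cdotP (phi psi : completion) x y :
  represents q x phi -> represents q y psi ->
  (fun n => q (x n) (y n)) @ \oo --> (cdot phi psi : C^o).
Proof.
move=> hx hy; apply: (represents_dot (crepP phi) hx (crepP psi) hy).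
by rewrite /cdot; case: cid.
Qed.

Lemma cdotPl a phi psi chi :
  cdot (a *: phi + psi) chi = a * cdot phi chi + cdot psi chi.
Proof.
have h := represents_lin a (crepP phi) (crepP psi).
apply: (cvgC_unique (@cdotP (a *: phi + psi) chi _ _ h (crepP chi))).
have := @cvgC_lin _ a _ _ _ _ (cdotP (crepP phi) (crepP chi)) (cdotP (crepP
  psi) (crepP chi)).
set f := (X in X @ _ --> _); set g := (X in _ -> X @ _ --> _).
suff -> : g = f by [].
by apply/funext => n; rewrite /f /g sdotPl.
Qed.

Lemma cdotC phi psi : cdot psi phi = conjC (cdot phi psi).
Proof.
apply: (cvgC_unique (cdotP (crepP psi) (crepP phi))).
have := cvg_conj (cdotP (crepP phi) (crepP psi)).
suff -> : (fun n => q (crep psi n) (crep phi n)) =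
          (fun n => conjC (q (crep phi n) (crep psi n))) by [].
by apply/funext => n; rewrite -sdotC.
Qed.

Lemma cdot_ge0 phi : 0 <= cdot phi phi.
Proof.
by apply: cvgC_ge0 (cdotP (crepP phi) (crepP phi)) => n; exact: sdot_ge0.
Qed.

Definition csemidot : semidot completion := Semidot cdotPl cdotC cdot_ge0.

Lemma cdot_eq0 phi : cdot phi phi = 0 -> phi = 0.
Proof.
move=> h0; apply: completion_ext => v; have rp := crepP phi; have [_ hp] := rp.
apply: (cvgC_unique (hp v)).
apply: (@null_dot _ _ q (crep phi) (fun=> v)); first exact: scauchy_cst.
apply/(@cvgrPdist_lt _ C^o) => e e0.
have /(@cvgrPdist_lt _ C^o) h := cdotP rp rp.
have e2 : 0 < e ^+ 2 by rewrite exprn_gt0.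
have := h _ e2; apply: filterS => n.
rewrite h0 !sub0r !normrN (ger0_norm (sdot_ge0 _ _)) (ger0_norm (snorm_ge0 _
  _)).
by rewrite -snorm_sqr ltr_pXn2r ?nnegrE ?snorm_ge0 ?ltW.
Qed.

HB.instance Definition _ := Lmodule_isNormed.Build C completion
  (snormD csemidot) (snormZ csemidot)
  (fun phi h => cdot_eq0 (etrans (esym (sqrtCK _))
     (etrans (congr1 (fun z => z ^+ 2) h) (expr0n C 2)))).

Lemma cnormE (phi : completion) : `|phi| = snorm csemidot phi.
Proof. by []. Qed.

Lemma represents_cst (v : E) : represents q (fun=> v) (q v).
Proof.
split; first exact: scauchy_cst.
by move=> w; exact: (@cvgC_cst R (q v w)).
Qed.

Fact embed_subproof (v : E) : q v \in representable.
Proof. by apply/asboolP; exists (fun=> v); exact: represents_cst. Qed.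

Definition embed (v : E) : completion := Completion (embed_subproof v).

Lemma cdot_embed v w : cdot (embed v) (embed w) = q v w.
Proof.
apply: (cvgC_unique (@cdotP (embed v) (embed w) _ _ (represents_cst v)
  (represents_cst w))).
exact: (@cvgC_cst R (q v w)).
Qed.

Lemma embedP (a : C) v w : embed (a *: v + w) = a *: embed v + embed w.
Proof. by apply: completion_ext => x; exact: sdotPl. Qed.

Lemma embedB v w : embed (v - w) = embed v - embed w.
Proof. by rewrite addrC -scaleN1r embedP scaleN1r addrC. Qed.

Lemma norm_embed v : `|embed v| = snorm q v.
Proof. by rewrite cnormE /snorm /= cdot_embed. Qed.

(** The pre-Hilbert space is dense in its completion: pass to the limit [m] to
    infinity in the Cauchy condition on [x m - x n]. *)
Lemma represents_embed_cvg x (phi : completion) : represents q x phi ->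
  forall e : C, 0 < e -> exists k, forall n, (k <= n)%N -> `|phi - embed (x n)|
    < e.
Proof.
move=> rx e e0; have [hx _] := rx.
have e2 : 0 < e / 2 by rewrite divr_gt0.
have [k hk] := hx _ e2; exists k => n kn.
rewrite cnormE -(@ltr_pXn2r _ 2) ?nnegrE ?snorm_ge0 ?(ltW e0) // snorm_sqr /=.
have r1 : represents q (fun m => x m - x n) (phi - embed (x n) : completion).
  have := represents_lin (-1) (represents_cst (x n)) rx.
  congr represents; apply/funext => m; first by rewrite scaleN1r addrC.
  by rewrite mulN1r addrC.
have /(@cvgrPdist_lt _ C^o) h := cdotP r1 r1.
have e4 : 0 < e ^+ 2 / 2 by rewrite divr_gt0 ?exprn_gt0.
have {}h := h _ e4.
rewrite -[ltLHS](ger0_norm (cdot_ge0 _)).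
near \oo => m.
rewrite -[X in `|X|](subrK (q (x m - x n) (x m - x n))).
rewrite (le_lt_trans (ler_normD _ _)) // [ltRHS](splitr (e ^+ 2)) ltrD //.
  by near: m.
rewrite (ger0_norm (sdot_ge0 _ _)) -snorm_sqr.
apply: (@lt_le_trans _ _ ((e / 2) ^+ 2)).
  rewrite ltr_pXn2r ?nnegrE ?snorm_ge0 ?(ltW e2) // hk //.
  by near: m; exists k.
rewrite expr_div_n ler_wpM2l ?exprn_ge0 ?(ltW e0) // lef_pV2 ?posrE ?exprn_gt0
  //.
by rewrite -natrX ler_nat.
Unshelve. all: by end_near. Qed.

End Completion.
Section CompletionHilbert.
Variables (R : realType) (E : lmodType R[i]) (q : semidot E).
Local Notation C := R[i].
Local Notation K := (completion q).

Fact cdot_bilinear : bilinear_for *%R (conjC \; *%R) (@cdot R E q).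
Proof.
split=> [u a x y|u a x y] /=; first exact: cdotPl.
rewrite (cdotC (_ + _) u) (cdotC x u) (cdotC y u) cdotPl.
by rewrite rmorphD rmorphM.
Qed.

HB.instance Definition _ :=
  @bilinear_isBilinear.Build C K K C *%R (conjC \;
    *%R) (@cdot R E q) cdot_bilinear.

Fact cdot_hermitian (x y : K) : cdot x y = (-1) ^+ false * conjC (cdot y x).
Proof. by rewrite expr0 mul1r -cdotC. Qed.

HB.instance Definition _ :=
  @isHermitianSesquilinear.Build C K false conjC (@cdot R E q) cdot_hermitian.

Fact cdot_gt0 (x : K) : x != 0 -> 0 < cdot x x.
Proof.
move=> x0; rewrite lt_def cdot_ge0 andbT; apply: contra x0 => /eqP x0.
by apply/eqP; exact: cdot_eq0.
Qed.

HB.instance Definition _ := @isDotProduct.Build C K (@cdot R E q) cdot_gt0.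

(** Choose [embed (x n)] within [1/(n+1)] of the centre of a ball of radius
    [1/(n+1)] belonging to the filter; two such balls meet, so that [x] is
    Cauchy, and it represents the limit of the filter. *)
Lemma completion_complete (F : set_system K) :
  ProperFilter F -> cauchy F -> cvg F.
Proof.
move=> FF /cauchyP hF.
have inv0 n : 0 < n.+1%:R^-1 :> C by rewrite invr_gt0 ltr0n.
(* Recentring a ball of the filter at a vector of the dense subspace doubles
   its radius. *)
have hx n : exists x : E, F (ball (embed q x) (n.+1%:R^-1 + n.+1%:R^-1)).
  have [phi hphi] := hF _ (inv0 n).
  have [k hk] := represents_embed_cvg (crepP phi) (inv0 n).
  exists (crep phi k); apply: filterS hphi => r hr.
  apply: le_lt_trans (ler_distD phi _ _) _; apply: ltrD; last exact: hr.
  by rewrite distrC hk.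
pose x n : E := projT1 (cid (hx n)).
have xP n : F (ball (embed q (x n)) (n.+1%:R^-1 + n.+1%:R^-1)).
  exact: projT2 (cid (hx n)).
have small (e : C) : 0 < e -> exists N, forall n, (N <= n)%N ->
    n.+1%:R^-1 + n.+1%:R^-1 < e / 2.
  move=> e0; have [|N hN] := @archi_invC R (e / 2 / 2);
    first by rewrite !divr_gt0.
  exists N => n Nn; rewrite [ltRHS](splitr (e / 2)).
  have : n.+1%:R^-1 < e / 2 / 2.
    by apply: le_lt_trans hN; rewrite lef_pV2 ?posrE ?ltr0n // ler_nat ltnS.
  by move=> h; rewrite ltrD.
have cx : scauchy q x.
  move=> e e0; have [N hN] := small _ e0; exists N => m n Nm Nn.
  have [r [hm hn]] := filter_ex (filterI (xP m) (xP n)).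
  rewrite -norm_embed embedB [ltRHS](splitr e).
  apply: le_lt_trans (ler_distD r _ _) _; apply: ltrD.
    exact: lt_trans (hm) (hN _ Nm).
  by rewrite distrC; exact: lt_trans (hn) (hN _ Nn).
have [phi rphi] := scauchy_represents cx.
have phiP : phi \in representable q by apply/asboolP; exists x.
apply/cvg_ex; exists (Completion phiP).
apply/cvgrPdist_lt => e e0; have [N1 hN1] := small _ e0.
have e2 : 0 < e / 2 by rewrite divr_gt0.
have [N2 hN2] := @represents_embed_cvg _ _ q x (Completion phiP) rphi _ e2.
apply: filterS (xP (maxn N1 N2)) => r hr.
rewrite [ltRHS](splitr e).
apply: le_lt_trans (ler_distD (embed q (x (maxn N1 N2))) _ _) _; apply: ltrD.
  by rewrite hN2 // leq_maxr.
by apply: lt_trans hr (hN1 _ _); rewrite leq_maxl.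
Qed.

HB.instance Definition _ := Uniform_isComplete.Build K completion_complete.

Fact completion_hdot_norm (x : K) : `|x| ^+ 2 = cdot x x.
Proof. by rewrite cnormE snorm_sqr. Qed.

HB.instance Definition _ :=
  @CompleteNormedModule_isHilbert.Build R K (@cdot R E q) completion_hdot_norm.

Lemma completion_hdotE (x y : K) : hdot x y = cdot x y.
Proof. by []. Qed.

End CompletionHilbert.

Lemma hilbert_ler_norm (R : realType) (H : hilbertType R) (x y : H) :
  hdot x x <= hdot y y -> `|x| <= `|y|.
Proof.
by move=> h; rewrite -(@ler_pXn2r _ 2) ?nnegrE ?normr_ge0 // !hdot_norm.
Qed.
(** * Contractions acting on the completion *)

Section Contractions.
Variables (R : realType) (E : lmodType R[i]) (q : semidot E).
Local Notation C := R[i].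
Local Notation K := (completion q).

(** An operator on the pre-Hilbert space with an adjoint defined on the same
    space; this is what allows to extend it to functionals by composition. *)
Record dot_contraction := DotContraction {
  fwd :> E -> E;
  bwd : E -> E;
  fwdB : forall x y, fwd (x - y) = fwd x - fwd y;
  bwdB : forall x y, bwd (x - y) = bwd x - bwd y;
  fwd_bwd : forall x y, q (fwd x) y = q x (bwd y);
  snorm_fwd : forall x, snorm q (fwd x) <= snorm q x;
  snorm_bwd : forall x, snorm q (bwd x) <= snorm q x }.

Lemma bwd_fwd (a : dot_contraction) x y : q (bwd a x) y = q x (a y).
Proof. by rewrite sdotC -fwd_bwd -sdotC. Qed.

Definition adjc (a : dot_contraction) : dot_contraction :=
  DotContraction (bwdB a) (fwdB a) (bwd_fwd a) (snorm_bwd a) (snorm_fwd a).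

Lemma represents_fwd (a : dot_contraction) x (phi : K) : represents q x phi ->
  represents q (fun n => a (x n)) (fun v => phi (bwd a v)).
Proof.
move=> [hx cx]; split.
  move=> e /hx[N hN]; exists N => m n Nm Nn.
  by rewrite -fwdB (le_lt_trans (snorm_fwd _ _)) // hN.
move=> v; have := cx (bwd a v).
suff -> : (fun n => q (a (x n)) v) = (fun n => q (x n) (bwd a v)) by [].
by apply/funext => n; rewrite fwd_bwd.
Qed.

Fact extend_subproof (a : dot_contraction) (phi : K) :
  (fun v => phi (bwd a v)) \in representable q.
Proof.
by apply/asboolP; exists (fun n => a (crep phi n));
  exact: represents_fwd (crepP _).
Qed.

(** The extension of [a] by continuity: a functional [phi] is the scalar product
    with a vector, and [<a x, v> = <x, a^* v>]. *)
Definition extend (a : dot_contraction) (phi : K) : K :=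
  Completion (extend_subproof a phi).

Fact extend_linear (a : dot_contraction) : linear (extend a).
Proof. by move=> c phi psi; apply: completion_ext. Qed.

HB.instance Definition _ (a : dot_contraction) :=
  GRing.isLinear.Build C K K *:%R (extend a) (extend_linear a).

Lemma extend_embed (a : dot_contraction) v : extend a (embed q v) = embed q (a
  v).
Proof. by apply: completion_ext => w; exact: esym (fwd_bwd _ _ _). Qed.

Lemma extend_adjoint (a : dot_contraction) :
  is_adjoint (extend a) (extend (adjc a)).
Proof.
move=> phi psi.
have h1 := @cdotP _ _ _ (extend a phi) psi _ _ (represents_fwd a (crepP phi))
  (crepP psi).
have h2 := @cdotP _ _ _ phi (extend (adjc a) psi) _ _ (crepP phi)
  (represents_fwd (adjc a) (crepP psi)).
apply: (cvgC_unique h1); move: h2.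
set f := (X in X @ _ --> _); set g := (X in _ -> X @ _ --> _).
suff -> : g = f by [].
by apply/funext => n; rewrite /f /g fwd_bwd.
Qed.

Lemma norm_extend (a : dot_contraction) (phi : K) : `|extend a phi| <= `|phi|.
Proof.
apply: (@hilbert_ler_norm R K).
rewrite -[hdot _ _]/(cdot _ _) -[leRHS]/(cdot _ _) -subr_ge0.
have r1 := crepP phi; have r2 := represents_fwd a r1.
have h1 := cdotP r1 r1.
have h2 := @cdotP _ _ _ (extend a phi) (extend a phi) _ _ r2 r2.
have := @cvgC_lin _ (-1) _ _ _ _ h2 h1; rewrite mulN1r addrC.
apply: cvgC_ge0 => n; rewrite mulN1r addrC subr_ge0 -!snorm_sqr.
by rewrite ler_pXn2r ?nnegrE ?snorm_ge0 ?snorm_fwd.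
Qed.

(** This gives the functional [phi] the conjugate linearity of the scalar
    product. *)
Lemma completion_reproducing (phi : K) v : phi v = cdot phi (embed q v).
Proof.
have [_ h] := crepP phi.
by apply: (cvgC_unique (h v)); exact: (@cdotP _ _ _ phi (embed q v) _ _ (crepP
  phi) (represents_cst q v)).
Qed.

(** A functional of the completion ignores null vectors: an identity between
    vectors that holds against all scalar products passes through it. *)
Lemma completion_sum_eq (I : finType) (phi : K) (v : I -> E) w :
  (forall x, \sum_i q x (v i) = q x w) -> \sum_i phi (v i) = phi w.
Proof.
move=> h; have [_ hc] := crepP phi.
under eq_bigr do rewrite completion_reproducing.
rewrite completion_reproducing -[LHS](linear_sumr (@cdot R E q)).
congr cdot; apply: completion_ext => x.
have ev : forall r : seq I, (\sum_(i <- r) embed q (v i) : K) x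
    = \sum_(i <- r) q (v i) x.
  elim => [|i r IH]; first by rewrite !big_nil.
  by rewrite !big_cons -IH.
rewrite [LHS]ev /= sdotC -h rmorph_sum /=.
by apply: eq_bigr => i _; rewrite -sdotC.
Qed.

(** Only the last hypothesis is tested through the semi-inner product: for
    multiplication operators [sum_j |a_j|^2 = 1] holds almost everywhere. *)
Lemma extend_spherical_unitary d (a : 'I_d -> dot_contraction) :
  (forall j k x, a j (a k x) = a k (a j x)) ->
  (forall j k x, bwd (a j) (bwd (a k) x) = bwd (a k) (bwd (a j) x)) ->
  (forall j x, a j (bwd (a j) x) = bwd (a j) (a j x)) ->
  (forall x y, \sum_j q (a j x) (a j y) = q x y) ->
  spherical_unitary (fun j => extend (a j)).
Proof.
move=> aC bC abC asum; split.
- move=> j; apply/linear_boundedP; exists 1; split=> [|k k1 phi];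
  first exact: real1.
  apply: le_trans (norm_extend _ _) _; rewrite ler_peMl ?normr_ge0 //.
  exact: ltW.
- by move=> j k phi; apply: completion_ext => v /=; rewrite bC.
- move=> j; exists (extend (adjc (a j))); first exact: extend_adjoint.
  by move=> phi; apply: completion_ext => v /=; rewrite abC.
exists (fun j => extend (adjc (a j))); first by move=> j; exact: extend_adjoint.
move=> phi; apply: completion_ext => v /=.
have ev : forall r : seq 'I_d,
    (\sum_(j <- r) extend (adjc (a j)) (extend (a j) phi) : K) v
    = \sum_(j <- r) phi (bwd (a j) (a j v)).
  elim => [|i r IH]; first by rewrite !big_nil.
  by rewrite !big_cons -IH.
rewrite [LHS]ev; apply: completion_sum_eq => x.
by rewrite -asum; apply: eq_bigr => j _; rewrite fwd_bwd.
Qed.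

End Contractions.
(** * Orthonormal families in Hilbert spaces *)

Section HilbertBasics.
Variables (R : realType) (H : hilbertType R).
Local Notation C := R[i].
Implicit Types x y z : H.

Fact hdot_linearl a x y z : hdot (a *: x + y) z = a * hdot x z + hdot y z.
Proof. by rewrite linearPl. Qed.

Fact hdot_sym x y : hdot y x = conjC (hdot x y).
Proof. by rewrite hermC expr0 mul1r. Qed.

Fact hdot_ge0 x : 0 <= hdot x x.
Proof. by rewrite -hdot_norm exprn_ge0. Qed.

Definition hsemidot : semidot H := Semidot hdot_linearl hdot_sym hdot_ge0.

Lemma hilbert_Cauchy_Schwarz x y : `|hdot x y| <= `|x| * `|y|.
Proof.
have e z : `|z| = snorm hsemidot z by rewrite /snorm /= -hdot_norm sqrCK.
rewrite !e; exact: (semi_Cauchy_Schwarz hsemidot).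
Qed.

Lemma cvg_hdot (x : nat -> H) y z : x @ \oo --> y ->
  (fun n => hdot (x n) z) @ \oo --> (hdot y z : C^o).
Proof.
move=> /cvgrPdist_lt h; apply/(@cvgrPdist_lt _ C^o) => e e0.
have z0 : 0 < `|z| + 1 by rewrite ltr_wpDl.
have := h _ (divr_gt0 e0 z0); apply: filterS => n.
rewrite ltr_pdivlMr // -linearBl => hn.
apply: le_lt_trans (hilbert_Cauchy_Schwarz _ _) _; apply: le_lt_trans hn.
by rewrite ler_wpM2l // lerDl.
Qed.

Lemma hdot_suml (I : Type) (r : seq I) (F : I -> H) z :
  hdot (\sum_(i <- r) F i) z = \sum_(i <- r) hdot (F i) z.
Proof. by rewrite linear_sumlz. Qed.

Lemma hdotZl a x y : hdot (a *: x) y = a * hdot x y.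
Proof. exact: (sdotZl hsemidot). Qed.

End HilbertBasics.

Section Transfer.
Variable R : realType.
Local Notation C := R[i].

(** Some vectors of the sequence may be [0] instead of having norm [1], so
    that a countable family can be enumerated with gaps. *)
Definition gapped_orthonormal (H : hilbertType R) (b : nat -> bool)
    (u : nat -> H) := forall m n, hdot (u m) (u n) = ((m == n) && b n)%:R.

Definition psum (A B : hilbertType R) (u : nat -> A) (v : nat -> B) (x : A) n :
  B :=
  \sum_(i < n) hdot x (u i) *: v i.

(** For orthonormal sequences, with gaps at the same indices, this is the partial
    isometry that sends [u n] to [v n] and vanishes on the orthogonal complement
    of the [u n]; with [u = v] it is the orthogonal projection on the closed span
    of [u]. *)
Definition transfer (A B : hilbertType R) (u : nat -> A) (v : nat -> B) (x : A)
  : B :=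
  lim (psum u v x @ \oo).

(** Projections and isometries are series determined by their coefficients, so
    that identities between them reduce to equalities of coefficients. *)
Lemma transfer_coef (A A' B : hilbertType R) (u : nat -> A) (u' : nat -> A')
    (v : nat -> B) x x' : (forall n, hdot x (u n) = hdot x' (u' n)) ->
  transfer u v x = transfer u' v x'.
Proof.
move=> h; rewrite /transfer; suff -> : psum u v x = psum u' v x' by [].
by apply/funext => n; rewrite /psum; under eq_bigr do rewrite h.
Qed.

Lemma gapped_coef (A : hilbertType R) b (u : nat -> A) x n :
  gapped_orthonormal b u -> (b n)%:R * hdot x (u n) = hdot x (u n).
Proof.
move=> hu; case bn : (b n); first by rewrite mul1r.
have := hu n n; rewrite bn andbF -hdot_norm => /eqP.
by rewrite expf_eq0 /= normr_eq0 => /eqP ->; rewrite linear0r mulr0.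
Qed.

Section Pair.
Variables (A B : hilbertType R) (b : nat -> bool).
Variables (u : nat -> A) (v : nat -> B).
Hypotheses (hu : gapped_orthonormal b u) (hv : gapped_orthonormal b v).

Lemma psum_dot x z n :
  hdot (psum u v x n) z = \sum_(i < n) hdot x (u i) * hdot (v i) z.
Proof. by rewrite hdot_suml; under eq_bigr do rewrite hdotZl. Qed.

Lemma psum_coef x m n : (m < n)%N -> hdot (psum u v x n) (v m) = hdot x (u m).
Proof.
move=> mn; rewrite psum_dot (bigD1 (Ordinal mn)) //= big1 ?addr0.
  by rewrite hv eqxx /= mulrC (gapped_coef _ _ hu).
by move=> i /negPf; rewrite hv -val_eqE /= => ->; rewrite mulr0.
Qed.

Lemma psum_sqr x m n : (m <= n)%N ->
  `|psum u v x n - psum u v x m| ^+ 2 = \sum_(m <= i < n) `|hdot x (u i)| ^+ 2.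
Proof.
move=> mn; rewrite /psum -!(big_mkord xpredT (fun i => hdot x (u i) *: v i)).
rewrite (big_cat_nat (leq0n m) mn) //= addrAC subrr add0r hdot_norm hdot_suml.
apply: eq_big_nat => i /andP[mi ni].
rewrite hdotZl [hdot (v i) _]hdot_sym hdot_suml.
rewrite (bigD1_seq i) ?iota_uniq ?mem_index_iota ?mi //= big1 ?addr0.
  by rewrite hdotZl hv eqxx /= [_ * (b i)%:R]mulrC (gapped_coef _ _ hu) normCK.
by move=> j /negPf; rewrite hdotZl hv => ->; rewrite mulr0.
Qed.

Lemma Bessel x n : \sum_(i < n) `|hdot x (u i)| ^+ 2 <= `|x| ^+ 2.
Proof.
have h : hdot (psum u u x n) x = \sum_(i < n) `|hdot x (u i)| ^+ 2.
  rewrite hdot_suml; apply: eq_bigr => i _.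
  by rewrite hdotZl [hdot (u i) x]hdot_sym normCK.
have hC : hdot x (psum u u x n) = \sum_(i < n) `|hdot x (u i)| ^+ 2.
  rewrite hdot_sym h rmorph_sum; apply: eq_bigr => i _.
  by rewrite rmorphXn /= conj_normC.
have hS : hdot (psum u u x n) (psum u u x n) = \sum_(i < n) `|hdot x (u i)| ^+
  2.
  rewrite [in LHS]/psum hdot_suml; apply: eq_bigr => i _.
  rewrite hdotZl [hdot (u i) _]hdot_sym hdot_suml (bigD1 i) //= big1 ?addr0.
    by rewrite hdotZl hu eqxx /= [_ * (b i)%:R]mulrC (gapped_coef _ _ hu)
      normCK.
  move=> j /negPf; rewrite hdotZl hu -val_eqE /= => ->; exact: mulr0.
have := hdot_ge0 (x - psum u u x n).
rewrite !linearBl !linearBr /= h hC hS subrr subr0 subr_ge0 -hdot_norm.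
exact.
Qed.

End Pair.
End Transfer.
Section TransferTheory.
Variable R : realType.
Local Notation C := R[i].

Section Pair.
Variables (A B : hilbertType R) (b : nat -> bool).
Variables (u : nat -> A) (v : nat -> B).
Hypotheses (hu : gapped_orthonormal b u) (hv : gapped_orthonormal b v).

(** The increments of the partial sums are those of [\sum_i |<x, u i>|^2], which
    is nondecreasing and bounded by Bessel's inequality. *)
Lemma psum_cvg x : psum u v x @ \oo --> transfer u v x.
Proof.
pose s n : C := \sum_(i < n) `|hdot x (u i)| ^+ 2.
have s_real n : s n = (Re (s n))%:C.
  by rewrite RRe_real // ger0_real // sumr_ge0 // => i _; rewrite exprn_ge0.
have sB m n : (m <= n)%N -> s n - s m = `|psum u v x n - psum u v x m| ^+ 2.
  move=> mn; rewrite (psum_sqr hu hv) // /s -!(big_mkord xpredT (fun i =>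
    `|hdot x (u i)| ^+ 2)).
  by rewrite (big_cat_nat (leq0n m) mn) //= addrAC subrr add0r.
have cs : cvgn (fun n => Re (s n)).
  apply: nondecreasing_is_cvgn.
    move=> m n mn; rewrite -lecR -!s_real -subr_ge0 sB // exprn_ge0.
  exists (Re (`|x| ^+ 2)) => _ [n _ <-].
  by rewrite -lecR -s_real RRe_real ?(Bessel hu) // rpredX ?normr_real.
apply: (@cauchy_seq_cvg _ B) => e e0.
have [e0' eE] : 0 < Re (e ^+ 2) /\ e ^+ 2 = (Re (e ^+ 2))%:C.
  by apply: gt0_complex; rewrite exprn_gt0.
have e2 : 0 < Re (e ^+ 2) / 2 by rewrite divr_gt0.
move/cvg_ex : cs => [l /cvgrPdist_lt/(_ _ e2)[N _ hN]].
have main m n : (N <= m)%N -> (m <= n)%N -> `|psum u v x n - psum u v x m| < e.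
  move=> Nm mn; rewrite -(@ltr_pXn2r _ 2) ?nnegrE ?(ltW e0) // -sB //.
  rewrite eE s_real (s_real m) -rmorphB /= ltcR.
  have h1 := hN _ Nm; have h2 := hN _ (leq_trans Nm mn).
  apply: le_lt_trans (ler_norm _) _; rewrite [ltRHS](splitr (Re (e ^+ 2))).
  apply: le_lt_trans (ler_distD l _ _) _; apply: ltrD => //.
  by rewrite distrC.
exists N => m n Nm Nn; have [mn|/ltnW nm] := leqP m n; last exact: main.
by rewrite distrC; exact: main.
Qed.

Lemma transfer_dot x m : hdot (transfer u v x) (v m) = hdot x (u m).
Proof.
have h1 := @cvg_hdot _ _ _ _ (v m) (@psum_cvg x).
apply: (cvgC_unique h1); apply/(@cvgrPdist_lt _ C^o) => e e0.
near=> n; rewrite (psum_coef hu hv) ?subrr ?normr0 //.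
by near: n; exists m.+1.
Unshelve. all: by end_near. Qed.

Fact transfer_linear : linear (transfer u v).
Proof.
move=> a x y; apply/cvg_lim; first exact: norm_hausdorff.
have -> : psum u v (a *: x + y) = (fun n => a *: psum u v x n + psum u v y n).
  apply/funext => n; rewrite /psum scaler_sumr -big_split;
    apply: eq_bigr => i _.
  by rewrite hdot_linearl scalerDl scalerA.
apply: cvgD; last exact: psum_cvg.
by apply: cvgZl_tmp; exact: psum_cvg.
Qed.

End Pair.

Lemma transfer_adjoint (A B : hilbertType R) b (u : nat -> A) (v : nat -> B)
    (hu : gapped_orthonormal b u) (hv : gapped_orthonormal b v) x z :
  hdot (transfer u v x) z = hdot x (transfer v u z).
Proof.
have h1 := @cvg_hdot _ _ _ _ z (@psum_cvg _ _ _ _ _ hu hv x).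
have h2 := cvg_conj (@cvg_hdot _ _ _ _ x (@psum_cvg _ _ _ _ _ hv hu z)).
rewrite [RHS]hdot_sym; apply: (cvgC_unique h1).
have e : (fun n => hdot (psum u v x n) z) = (fun n => conjC (hdot (psum v u z
  n) x)).
  apply/funext => n; rewrite !psum_dot rmorph_sum; apply: eq_bigr => i _.
  by rewrite rmorphM /= -[conjC (hdot z (v i))]hdot_sym -[conjC (hdot (u i)
    x)]hdot_sym mulrC.
by rewrite e.
Qed.

Lemma transfer_comp (A B D : hilbertType R) b (u : nat -> A) (v : nat -> B)
    (w : nat -> D) (hu : gapped_orthonormal b u) (hv : gapped_orthonormal b v)
      x :
  transfer v w (transfer u v x) = transfer u w x.
Proof. by apply: transfer_coef => n; rewrite (transfer_dot hu hv). Qed.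

End TransferTheory.

Section CountableFamilies.
Variables (R : realType) (I : countType).
Local Notation C := R[i].

Definition enumerate (H : hilbertType R) (e : I -> H) (n : nat) : H :=
  if pickle_inv n is Some i then e i else 0.

Lemma enumerate_pickle (H : hilbertType R) (e : I -> H) i :
  enumerate e (pickle i) = e i.
Proof. by rewrite /enumerate pickleK_inv. Qed.

Lemma enumerate_gapped (H : hilbertType R) (e : I -> H) :
  (forall i j, hdot (e i) (e j) = (i == j)%:R) ->
  gapped_orthonormal (fun n => @pickle_inv I n) (enumerate e).
Proof.
move=> he m n; rewrite /enumerate.
have inj k (i : I) : pickle_inv k = Some i -> pickle i = k.
  by move=> h; have := @pickle_invK I k; rewrite h.
case hm : (pickle_inv m) => [i|]; last first.
  by rewrite linear0l; case: eqP => // <-; rewrite hm.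
case hn : (pickle_inv n) => [j|]; last by rewrite linear0r andbF.
rewrite he andbT; congr (_%:R); congr nat_of_bool; apply/eqP/eqP => [ij|mn].
  by rewrite -(inj _ _ hm) -(inj _ _ hn) ij.
by move: hm; rewrite mn hn => -[->].
Qed.

(** A bounded linear functional vanishing on a basis vanishes, by density of the
    finite combinations of the basis vectors. *)
Lemma basis_ext0 (H : hilbertType R) (e : I -> H) (F : H -> C) (M : C) :
  orthonormal_basis e ->
  (forall a x y, F (a *: x + y) = a * F x + F y) ->
  (forall x, `|F x| <= M * `|x|) -> (forall i, F (e i) = 0) -> forall x, F x =
    0.
Proof.
move=> [_ cl] Flin Fbd Fe x.
have F0 : F 0 = 0 by apply/normr0_eq0/le_anti;
  rewrite (le_trans (Fbd _)) ?normr0 ?mulr0 /=.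
have Fsum (s : seq I) c : F (\sum_(i <- s) c i *: e i) = 0.
  elim: s => [|i s IH]; first by rewrite big_nil.
  by rewrite big_cons Flin IH Fe mulr0 addr0.
have FB y z : F (y - z) = F y - F z.
  by rewrite -[y - z]addrC -scaleN1r Flin mulN1r addrC.
have M0 : 0 <= `|M| by [].
apply/eqP; rewrite -normr_le0; apply/negPn/negP => h.
have Fx0 : 0 < `|F x| by rewrite normr_gt0; apply: contra h => /eqP ->;
  rewrite normr0.
have e0 : 0 < `|F x| / (`|M| + 1) by rewrite divr_gt0 // ltr_wpDl.
have xcl : closure [set x | exists (s : seq I) (c : I -> C), x = \sum_(i <- s)
  c i *: e i] x.
  by rewrite cl.
have [_ [[s [c ->]] hs]] := xcl _ (nbhsx_ballx x _ e0).
move: hs; rewrite -ball_normE /= ltr_pdivlMr ?ltr_wpDl // => hs.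
have := Fbd (x - \sum_(i <- s) c i *: e i); rewrite FB Fsum subr0.
set r := `|x - _| in hs *.
have r0 : 0 <= r by rewrite normr_ge0.
move=> h2; have h3 : M * r <= `|M| * r + r.
  apply: (@le_trans _ _ `|M * r|).
    apply: real_ler_norm; have : 0 <= M * r by apply: le_trans h2.
    exact: ger0_real.
  by rewrite normrM (ger0_norm r0) lerDl.
move: hs; rewrite mulrDr mulr1 mulrC => hs.
by have := le_lt_trans (le_trans h2 h3) hs; rewrite ltxx.
Qed.

(** Parseval: the difference between [x] and the sum of its orthonormal
    expansion is orthogonal to the whole basis. *)
Lemma basis_transfer (H : hilbertType R) (e : I -> H) x : orthonormal_basis e ->
  transfer (enumerate e) (enumerate e) x = x.
Proof.
move=> be; have hg := enumerate_gapped be.1.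
set y := transfer _ _ x.
have he i : hdot (y - x) (e i) = 0.
  by rewrite -(enumerate_pickle e i) linearBl /= (transfer_dot hg hg) subrr.
suff h : hdot (y - x) (y - x) = 0.
  apply/eqP; rewrite -subr_eq0 -normr_eq0; apply/eqP.
  by move/eqP: h; rewrite -hdot_norm expf_eq0 /= => /eqP.
rewrite hdot_sym -(conjC0 C); congr (conjC _).
apply: (@basis_ext0 H e (fun z => hdot z (y - x)) `|y - x| be).
- by move=> a z t; rewrite hdot_linearl.
- by move=> z; rewrite mulrC hilbert_Cauchy_Schwarz.
by move=> i; rewrite hdot_sym he conjC0.
Qed.

End CountableFamilies.
(** * A criterion for spherical dilations *)

Section TuplePowers.
Variables (R : realType) (d : nat) (H : hilbertType R).
Variable T : 'I_d -> {linear H -> H}.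
Local Notation C := R[i].

Definition bounded_linear (A B : hilbertType R) (f : A -> B) : Prop :=
  (forall a x y, f (a *: x + y) = a *: f x + f y) /\
  exists2 M : C, 0 <= M & forall x, `|f x| <= M * `|x|.

Lemma bounded_linear_comp (A B D : hilbertType R) (f : B -> D) (g : A -> B) :
  bounded_linear f -> bounded_linear g -> bounded_linear (f \o g).
Proof.
move=> [fl [M M0 fM]] [gl [N N0 gN]]; split.
  by move=> a x y /=; rewrite gl fl.
exists (M * N) => [|x /=]; first exact: mulr_ge0.
by rewrite (le_trans (fM _)) // -mulrA ler_wpM2l.
Qed.

Lemma bounded_linear_tuple_pow I : bounded_tuple T ->
  bounded_linear (tuple_pow T I).
Proof.
move=> bT; have bid : bounded_linear (@idfun H).
  by split=> //; exists 1 => // x; rewrite mul1r.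
rewrite /tuple_pow; apply: big_ind => //; first exact: bounded_linear_comp.
move=> j _; elim: (I j) => [//|n IH].
have -> : iter n.+1 (T j) = T j \o iter n (T j) by [].
apply: bounded_linear_comp IH; split=> [a x y|]; first exact: linearP.
have /linear_boundedP/pinfty_ex_gt0[M M0 hM] := bT j.
by exists M => //; exact: ltW.
Qed.

(** To follow the orbit of a vector under the powers of [T] it is enough to
    follow it through the action of each [T j]. *)
Lemma tuple_pow_orbit (Q : multi_index d -> H -> Prop) :
  (forall J j x, Q J x -> Q (J + eps j) (T j x)) ->
  forall I J x, Q J x -> Q (I + J) (tuple_pow T I x).
Proof.
move=> Qs I J x QJ; rewrite /tuple_pow.
(* The induction over the coordinates already treated needs the exponents
   restricted to those coordinates. *)
pose restr (r : seq 'I_d) : multi_index d := [ffun j => if j \in r then I j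
  else 0%N].
suff main r : uniq r -> Q (restr r + J)
    ((\big[(fun f g => f \o g)/idfun]_(j <- r) iter (I j) (T j)) x).
  have rE : restr (index_enum 'I_d) = I.
    by apply/ffunP => j; rewrite ffunE mem_index_enum.
  by rewrite -{1}rE; apply: main; exact: index_enum_uniq.
elim: r => [_|i r IH /= /andP[ir ur]].
  rewrite big_nil /=; suff -> : restr [::] + J = J by [].
  by apply/ffunP => j; rewrite !ffunE add0r.
rewrite big_cons /=.
have it n y K : Q K y -> Q (K + eps i *+ n) (iter n (T i) y).
  elim: n => [|n IHn] QK; first by rewrite mulr0n addr0.
  by rewrite mulrSr addrA; apply: Qs; exact: IHn.
have -> : restr (i :: r) + J = restr r + J + eps i *+ I i.
  apply/ffunP => j; rewrite !(ffunE, ffunMnE) in_cons /=.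
  have [->|ji] /= := eqVneq j i; last by rewrite mul0rn addr0.
  by rewrite (negPf ir) add0r addrC natn.
exact/it/IH.
Qed.

End TuplePowers.

(** Let [V] be the isometry sending [e J] to [f J] and [P] the projection on the
    span of [f]. Both [V (T^I x)] and [P (U^I (V x))] are expansions along [f];
    their coefficients are bounded linear functionals of [x] that agree on the
    basis [e]. *)
Lemma spherical_dilation_criterion (R : realType) (d : nat) (H K : hilbertType
  R)
    (e : multi_index d -> H) (f : multi_index d -> K)
    (T : 'I_d -> {linear H -> H}) (U : 'I_d -> {linear K -> K}) :
  orthonormal_basis e -> (forall I J, hdot (f I) (f J) = (I == J)%:R) ->
  bounded_tuple T -> spherical_unitary U ->
  (forall I J L, hdot (tuple_pow U I (f J)) (f L) =
                 hdot (tuple_pow T I (e J)) (e L)) ->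
  admits_spherical_dilation T.
Proof.
move=> be fo bT sU hUT.
have ge := enumerate_gapped be.1; have gf := enumerate_gapped fo.
have [V VE] : exists V : {linear H -> K},
    forall x, V x = transfer (enumerate e) (enumerate f) x.
  pose V : {linear H -> K} := HB.pack (transfer (enumerate e) (enumerate f))
    (GRing.isLinear.Build R[i] H K *:%R _ (transfer_linear ge gf)).
  by exists V.
have isoV x y : hdot (V x) (V y) = hdot x y.
  by rewrite !VE (transfer_adjoint ge gf) (transfer_comp _ ge gf)
    (basis_transfer _ be).
have normV x : `|V x| = `|x|.
  by apply/eqP; rewrite -(@eqrXn2 _ 2) // !hdot_norm isoV.
exists K, V, (transfer (enumerate f) (enumerate f)), U.
split; [exact: isoV| |exact: sU|].
  move=> y; split.
    exists (transfer (enumerate f) (enumerate e) y); first by [].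
    by rewrite VE (transfer_comp _ gf ge).
  move=> _ [x _ <-]; rewrite linearBl /= (transfer_adjoint gf gf) VE.
  by rewrite (transfer_comp _ ge gf) subrr.
move=> I x; rewrite VE; apply: transfer_coef => n.
rewrite /enumerate; case: (pickle_inv n) => [L|]; last by rewrite !linear0r.
apply/eqP; rewrite -subr_eq0; apply/eqP.
have [Tl [M M0 hM]] := bounded_linear_tuple_pow I bT.
have [Ul [N N0 hN]] := bounded_linear_tuple_pow I (let: And4 b _ _ _ := sU in
  b).
apply: (@basis_ext0 _ _ H e
  (fun x => hdot (tuple_pow T I x) (e L) - hdot (tuple_pow U I (V x)) (f L))
  (M * `|e L| + N * `|f L|) be).
- move=> a y z; rewrite linearP Tl Ul !hdot_linearl; ring.
- move=> y; rewrite mulrDl (le_trans (ler_normB _ _)) // lerD //.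
    rewrite (le_trans (hilbert_Cauchy_Schwarz _ _)) // mulrAC ler_wpM2r //.
  rewrite (le_trans (hilbert_Cauchy_Schwarz _ _)) // mulrAC ler_wpM2r //.
  by rewrite (le_trans (hN _)) // normV.
move=> J; suff -> : V (e J) = f J by rewrite hUT subrr.
apply/eqP; rewrite -subr_eq0 -normr_eq0 -sqrf_eq0 hdot_norm.
(* Two unit vectors with scalar product [1] are equal. *)
have h : hdot (V (e J)) (f J) = 1.
  by rewrite VE -(enumerate_pickle f J) (transfer_dot ge gf) enumerate_pickle
    be.1 eqxx.
rewrite linearBl !linearBr /= isoV be.1 fo eqxx h [hdot (f J) (V _)]hdot_sym h.
by rewrite conjC1 !subrr.
Qed.
(** * Integration of bounded complex functions *)

Section BoundedFunctions.
Context (dX : measure_display) (X : measurableType dX) (R : realType).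
Variables (m : {measure set X -> \bar R}) (D : set X).
Local Notation C := R[i].
Implicit Types f g : X -> C.

(** The bound is only required on the domain [D] of integration, as monomials
    are bounded on the sphere but not on the whole space. *)
Definition bounded_measurable f : Prop :=
  [/\ measurable_fun setT (fun x => Re (f x)), measurable_fun setT (fun x => Im
    (f x)) &
      exists B : R, forall x, D x -> `|f x| <= B%:C].

Lemma bounded_measurable_cst (c : C) : bounded_measurable (fun=> c).
Proof.
split; [exact: measurable_cst|exact: measurable_cst|].
by exists (Re `|c|) => x _; rewrite RRe_real ?normr_real.
Qed.

Lemma bounded_measurable_conj f :
  bounded_measurable f -> bounded_measurable (fun x => conjC (f x)).
Proof.
move=> [mr mi [B hB]]; split.
- by move: mr; congr measurable_fun; apply/funext => x; case: (f x).
- move: (measurable_funM (@measurable_cst _ _ _ _ setT (-1 : R)) mi).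
  by congr measurable_fun; apply/funext => x /=; rewrite mulN1r; case: (f x).
- by exists B => x Dx; rewrite norm_conjC hB.
Qed.

Lemma bounded_measurableD f g : bounded_measurable f -> bounded_measurable g ->
  bounded_measurable (fun x => f x + g x).
Proof.
move=> [mr mi [B hB]] [mr' mi' [B' hB']]; split.
- move: (measurable_funD mr mr'); congr measurable_fun; apply/funext => x /=.
  by case: (f x) (g x) => [? ?] [? ?].
- move: (measurable_funD mi mi'); congr measurable_fun; apply/funext => x /=.
  by case: (f x) (g x) => [? ?] [? ?].
- exists (B + B') => x Dx; rewrite rmorphD /= (le_trans (ler_normD _ _)) //.
  by rewrite lerD ?hB ?hB'.
Qed.

Lemma bounded_measurableM f g : bounded_measurable f -> bounded_measurable g ->
  bounded_measurable (fun x => f x * g x).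
Proof.
move=> [mr mi [B hB]] [mr' mi' [B' hB']]; split.
- move: (measurable_funB (measurable_funM mr mr') (measurable_funM mi mi')).
  by congr measurable_fun; apply/funext => x /=;
    case: (f x) (g x) => [? ?] [? ?].
- move: (measurable_funD (measurable_funM mr mi') (measurable_funM mi mr')).
  by congr measurable_fun; apply/funext => x /=;
    case: (f x) (g x) => [? ?] [? ?].
- exists (B * B') => x Dx; rewrite rmorphM /= normrM.
  by rewrite ler_pM ?hB ?hB'.
Qed.

Definition Cint f : C :=
  (Rintegral m D (fun x => Re (f x))) +i* (Rintegral m D (fun x => Im (f x))).

Lemma eq_Cint f g : (forall x, D x -> f x = g x) -> Cint f = Cint g.
Proof.
by move=> h; congr Complex; apply: eq_Rintegral => x /set_mem/h ->.
Qed.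

Lemma Cint_ge0 f : (forall x, D x -> 0 <= f x) -> 0 <= Cint f.
Proof.
move=> h; rewrite lecE /=; apply/andP; split.
  apply/eqP; rewrite (@eq_Rintegral _ _ _ m D (fun=> 0)).
    by rewrite /Rintegral integral0_eq.
  by move=> x /set_mem/h; exact: ger0_Im.
by apply: Rintegral_ge0 => x /h; rewrite lecE => /andP[].
Qed.

Hypotheses (mD : measurable D) (mDoo : (m D < +oo)%E).

Lemma bounded_integrable (g : X -> R) (B : R) : measurable_fun setT g ->
  (forall x, D x -> `|g x| <= B) -> m.-integrable D (EFin \o g).
Proof.
move=> mg hB; apply: measurable_bounded_integrable => //;
  first exact: measurable_funTS.
by exists B; split; rewrite ?num_real // => M BM x Dx;
  exact: (le_trans (hB _ Dx) (ltW BM)).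
Qed.

Lemma integrable_Re f : bounded_measurable f ->
  m.-integrable D (EFin \o (fun x => Re (f x))).
Proof.
move=> [mr _ [B hB]]; apply: (bounded_integrable mr) => x /hB h.
by rewrite -lecR; exact: le_trans (normc_ge_Re _) h.
Qed.

Lemma integrable_Im f : bounded_measurable f ->
  m.-integrable D (EFin \o (fun x => Im (f x))).
Proof.
move=> [_ mi [B hB]]; apply: (bounded_integrable mi) => x /hB h.
by rewrite -lecR; exact: le_trans (normc_ge_Im _) h.
Qed.

Lemma CintD f g : bounded_measurable f -> bounded_measurable g ->
  Cint (fun x => f x + g x) = Cint f + Cint g.
Proof.
move=> bf bg; rewrite {2 3}/Cint.
rewrite -[RHS]/((_ + _) +i* (_ + _)) -!RintegralD //;
  try exact: integrable_Re; try exact: integrable_Im.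
by congr Complex; apply: eq_Rintegral => x _; case: (f x) (g x) => [? ?] [? ?].
Qed.

Lemma CintZ (c : C) f : bounded_measurable f ->
  Cint (fun x => c * f x) = c * Cint f.
Proof.
move=> bf; case: c => a b; rewrite {2}/Cint.
rewrite -[RHS]/((_ - _) +i* (_ + _)).
have iR := integrable_Re bf; have iI := integrable_Im bf.
have iZ r (h : X -> R) : m.-integrable D (EFin \o h) ->
    m.-integrable D (EFin \o (fun x => r * h x)) by exact: integrableZl.
rewrite -!RintegralZl // -RintegralB //; try exact: iZ.
rewrite -RintegralD //; try exact: iZ.
by congr Complex; apply: eq_Rintegral => x _; case: (f x) => [? ?].
Qed.

Lemma Cint_conj f : bounded_measurable f ->
  Cint (fun x => conjC (f x)) = conjC (Cint f).
Proof.
move=> bf; rewrite conjcE /Cint /= -[- _]mulN1r -RintegralZl //;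
  last exact: integrable_Im.
by congr Complex; apply: eq_Rintegral => x _; rewrite ?mulN1r; case: (f x).
Qed.

End BoundedFunctions.
(** * The space of bounded measurable functions *)

Section BoundedFunctionSpace.
Context (dX : measure_display) (X : measurableType dX) (R : realType).
Variable D : set X.
Local Notation C := R[i].

Definition bounded_measurable_pred : {pred X -> C} :=
  fun f => `[< bounded_measurable D f >].

Fact bounded_measurable_submod : submod_closed bounded_measurable_pred.
Proof.
split; first by apply/asboolP; exact: (bounded_measurable_cst D 0).
move=> a f g /asboolP hf /asboolP hg; apply/asboolP.
apply: bounded_measurableD => //.
exact: (bounded_measurableM (bounded_measurable_cst D a)).
Qed.

HB.instance Definition _ := GRing.isSubmodClosed.Build C (X -> C)
  bounded_measurable_pred bounded_measurable_submod.

Record bfun := Bfun {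
  bfun_val :> X -> C;
  bfun_pred : bfun_val \in bounded_measurable_pred }.

HB.instance Definition _ := [isSub for bfun_val].
HB.instance Definition _ := gen_eqMixin bfun.
HB.instance Definition _ := gen_choiceMixin bfun.
HB.instance Definition _ := [SubChoice_isSubLmodule of bfun by <:].

Lemma bfunP (f : bfun) : bounded_measurable D f.
Proof. by apply/asboolP; exact: bfun_pred. Qed.

Definition mkbfun (f : X -> C) (hf : bounded_measurable D f) : bfun :=
  Bfun (introT (asboolP _) hf : f \in bounded_measurable_pred).

Lemma bfun_ext (f g : bfun) : f =1 g -> f = g.
Proof. by move=> h; apply/val_inj/funext. Qed.

Variable m : {measure set X -> \bar R}.
Hypotheses (mD : measurable D) (mDoo : (m D < +oo)%E).

Lemma bounded_measurable_prod (f g : bfun) :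
  bounded_measurable D (fun x => f x * conjC (g x)).
Proof.
by apply: bounded_measurableM; [|apply: bounded_measurable_conj]; exact: bfunP.
Qed.

Definition bdot (f g : bfun) : C := Cint m D (fun x => f x * conjC (g x)).

Fact bdotPl a f g h : bdot (a *: f + g) h = a * bdot f h + bdot g h.
Proof.
rewrite /bdot -CintZ //; last exact: bounded_measurable_prod.
rewrite -CintD //; last exact: bounded_measurable_prod.
  by apply: eq_Cint => x _; rewrite /= mulrDl mulrA.
apply: (bounded_measurableM (bounded_measurable_cst D a)).
exact: bounded_measurable_prod.
Qed.

Fact bdotC f g : bdot g f = conjC (bdot f g).
Proof.
rewrite /bdot -Cint_conj //; last exact: bounded_measurable_prod.
by apply: eq_Cint => x _; rewrite rmorphM /= conjCK mulrC.
Qed.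

Fact bdot_ge0 f : 0 <= bdot f f.
Proof. by apply: Cint_ge0 => x _; rewrite -normCK exprn_ge0. Qed.

Definition bsemidot : semidot bfun := Semidot bdotPl bdotC bdot_ge0.

Section Multiplication.
Variable a : X -> C.
Hypotheses (ba : bounded_measurable D a) (a1 : forall x, D x -> `|a x| <= 1).

Definition bmul (c : X -> C) (hc : bounded_measurable D c) (f : bfun) : bfun :=
  mkbfun (bounded_measurableM hc (bfunP f)).

Fact bmulB (c : X -> C) (hc : bounded_measurable D c) f g :
  bmul hc (f - g) = bmul hc f - bmul hc g.
Proof. by apply: bfun_ext => x; exact: mulrBr. Qed.

Fact bmul_adjoint f g :
  bdot (bmul ba f) g = bdot f (bmul (bounded_measurable_conj ba) g).
Proof.
by apply: eq_Cint => x _ /=; rewrite rmorphM /= conjCK mulrCA mulrA.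
Qed.

Fact bmul_contract (c : X -> C) (hc : bounded_measurable D c) f :
  (forall x, D x -> `|c x| <= 1) -> snorm bsemidot (bmul hc f) <= snorm
    bsemidot f.
Proof.
move=> c1; rewrite -(@ler_pXn2r _ 2) ?nnegrE ?snorm_ge0 // !snorm_sqr /=
  -subr_ge0.
have h := bounded_measurable_prod f f.
have hc' := bounded_measurable_prod (bmul hc f) (bmul hc f).
have hN := bounded_measurableM (bounded_measurable_cst D (-1)) hc'.
have -> : bdot f f - bdot (bmul hc f) (bmul hc f) =
  Cint m D (fun x => f x * conjC (f x) +
     (-1) * (bmul hc f x * conjC (bmul hc f x))).
  by rewrite CintD // CintZ // mulN1r.
apply: Cint_ge0 => x Dx; rewrite mulN1r subr_ge0 -!normCK /= normrM.
rewrite ler_pXn2r ?nnegrE ?mulr_ge0 //.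
by rewrite ler_piMl ?c1.
Qed.

Definition mul_contraction : dot_contraction bsemidot.
Proof.
apply: (@DotContraction _ _ bsemidot (bmul ba) (bmul (bounded_measurable_conj
  ba))).
- exact: bmulB.
- exact: bmulB.
- exact: bmul_adjoint.
- by move=> f; exact: bmul_contract.
- by move=> f; apply: bmul_contract => x Dx; rewrite norm_conjC a1.
Defined.

End Multiplication.

Lemma bdot_sum (I : Type) (r : seq I) (F G : I -> bfun) (f g : bfun) :
  (forall x, D x -> \sum_(i <- r) F i x * conjC (G i x) = f x * conjC (g x)) ->
  \sum_(i <- r) bdot (F i) (G i) = bdot f g.
Proof.
move=> h; rewrite /bdot -(eq_Cint m h).
have bs (s : seq I) : bounded_measurable D (fun x => \sum_(i <- s) F i x *
  conjC (G i x)).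
  elim: s => [|i s IH].
    move: (bounded_measurable_cst (X := X) D (0 : C)); congr bounded_measurable.
    by apply/funext => x; rewrite big_nil.
  move: (bounded_measurableD (bounded_measurable_prod (F i) (G i)) IH).
  by congr bounded_measurable; apply/funext => x; rewrite big_cons.
elim: r {h} => [|i r IH].
  rewrite big_nil; transitivity (Cint m D (fun=> (0 : C) * 0)).
    by rewrite CintZ ?mul0r //; exact: bounded_measurable_cst.
  by apply: eq_Cint => x _; rewrite big_nil mul0r.
rewrite big_cons IH -CintD //; last exact: bounded_measurable_prod.
by apply: eq_Cint => x _; rewrite big_cons.
Qed.

(** Multiplication operators are normal and commute; their squared moduli need
    to add up to [1] on the domain of integration only. *)
Lemma mul_spherical_unitary n (a : 'I_n -> X -> C)
    (ba : forall j, bounded_measurable D (a j))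
    (a1 : forall j x, D x -> `|a j x| <= 1) :
  (forall x, D x -> \sum_j `|a j x| ^+ 2 = 1) ->
  spherical_unitary (fun j => extend (mul_contraction (ba j) (a1 j))).
Proof.
move=> sa; apply: extend_spherical_unitary.
- by move=> j k f; apply: bfun_ext => x /=; rewrite mulrCA.
- by move=> j k f; apply: bfun_ext => x /=; rewrite mulrCA.
- by move=> j f; apply: bfun_ext => x /=; rewrite mulrCA.
move=> f g; apply: bdot_sum => x Dx /=.
rewrite -[RHS]mul1r -(sa _ Dx) mulr_suml; apply: eq_bigr => j _.
rewrite rmorphM normCK /=; ring.
Qed.

End BoundedFunctionSpace.
(** * Monomials on the sphere *)

Section SphereFunctions.
Variables (R : realType) (d : nat).
Local Notation C := R[i].
Local Notation Cvec := 'rV[C^o]_d.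
Local Notation S := (@sphere R d).
Implicit Types (I J : multi_index d) (z u : Cvec).

(** The measurable structure is generated by the open sets of [C^d]. *)
Lemma continuous_borelC (g : Cvec -> R) : continuous g ->
  measurable_fun setT (g : borelC R d -> R).
Proof.
move=> /continuousP cg; apply: (measurability _ (RGenOpens.measurableE R)).
move=> _ [_ [a [b ->] <-]]; rewrite setTI.
by apply: sub_sigma_algebra; exact/cg/interval_open.
Qed.

Lemma continuous_contractC (f : C -> R) : (forall x y, f (x - y) = f x - f y) ->
  (forall x, (`|f x|)%:C <= `|x|) -> continuous (f : C^o -> R).
Proof.
move=> fB fn x; have xF := nbhs_filter (x : C^o); apply/cvgrPdist_lt => e e0.
have e0' : 0 < e%:C :> C by rewrite ltcR.
have := @nbhsx_ballx _ C^o x _ e0'.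
apply: (@filterS _ (nbhs (x : C^o)) (nbhs_filter (x : C^o))) => y.
by rewrite -ball_normE /= => h; rewrite -fB -ltcR; exact: le_lt_trans (fn _) h.
Qed.

Lemma bounded_measurable_coord (j : 'I_d) :
  bounded_measurable S (fun z : borelC R d => z 0 j : C).
Proof.
have cc (f : C -> R) : continuous (f : C^o -> R) ->
    measurable_fun setT (fun z : borelC R d => f (z 0 j)).
  move=> cf; apply: (@continuous_borelC (fun z => f (z 0 j))) => z.
  by apply: continuous_comp; [exact: coord_continuous|exact: cf].
split.
- by apply: cc; apply: continuous_contractC => [[? ?] [? ?]|x] //;
  exact: normc_ge_Re.
- by apply: cc; apply: continuous_contractC => [[? ?] [? ?]|x] //;
  exact: normc_ge_Im.
exists 1 => z Sz; rewrite -(@ler_pXn2r _ 2) ?nnegrE // expr1n -Sz (bigD1 j) //=.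
by rewrite lerDl sumr_ge0 // => k _; rewrite exprn_ge0.
Qed.

Lemma norm_coord_sphere z j : S z -> `|z 0 j : C| <= 1.
Proof.
move=> Sz; rewrite -(@ler_pXn2r _ 2) ?nnegrE // expr1n -Sz (bigD1 j) //=.
by rewrite lerDl sumr_ge0 // => k _; rewrite exprn_ge0.
Qed.

Lemma bounded_measurable_monomial I :
  bounded_measurable S (fun z : borelC R d => monomial I z).
Proof.
rewrite /monomial; elim: index_enum => [|j r IH].
  move: (bounded_measurable_cst (X := borelC R d) S (1 : C)).
  by congr bounded_measurable; apply/funext => z; rewrite big_nil.
have bX n : bounded_measurable S (fun z : borelC R d => (z 0 j : C) ^+ n).
  elim: n => [|n IHn]; first exact: (bounded_measurable_cst (X := borelC R d)).
  move: (bounded_measurableM (bounded_measurable_coord j) IHn).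
  by congr bounded_measurable; apply/funext => z; rewrite exprS.
move: (bounded_measurableM (bX (I j)) IH).
by congr bounded_measurable; apply/funext => z; rewrite big_cons.
Qed.

Lemma measurable_sphere : measurable S.
Proof.
pose g (z : borelC R d) : R :=
  \sum_(j < d) (Re (z 0 j : C) ^+ 2 + Im (z 0 j : C) ^+ 2).
have mg : measurable_fun setT g.
  apply: measurable_sum => j; have [mr mi _] := bounded_measurable_coord j.
  by apply: measurable_funD; apply: measurable_funX.
have -> : S = setT `&` g @^-1` [set 1].
  have gE z : \sum_(j < d) `|z 0 j : C| ^+ 2 = (g z)%:C.
    by rewrite rmorph_sum; apply: eq_bigr => j _; rewrite -add_Re2_Im2.
  rewrite setTI; apply/seteqP; split => z; rewrite /sphere /= gE.
    by move/complexI.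
  by move=> ->.
by apply: mg => //; exact: measurable_set1.
Qed.

Lemma cmul_continuous u : continuous (cmul u).
Proof.
move=> z A [P hP sPA].
exists (fun i j => [set x : C^o | P i j (u 0 j * x)]); last first.
  by move=> N hN; apply: sPA => i j; rewrite mxE (ord1 i); exact: hN.
move=> i j; have := hP i j; rewrite mxE (ord1 i).
have : {for z 0 j, continuous (fun x : C^o => (u 0 j * x : C^o))}.
  exact: (@mulrl_continuous C).
by apply.
Qed.

Lemma measurable_cmul u :
  measurable_fun setT (cmul u : borelC R d -> borelC R d).
Proof.
apply: (@measurability _ _ (borelC R d) (borelC R d) setT (cmul u) (@open
  Cvec)); first by [].

move=> _ [A oA <-]; rewrite setTI; apply: sub_sigma_algebra.
by move/continuousP: (@cmul_continuous u); apply.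
Qed.

Lemma monomial_cmul I u z : monomial I (cmul u z) = monomial I u * monomial I z.
Proof.
by rewrite /monomial -big_split; apply: eq_bigr => j _; rewrite mxE exprMn.
Qed.

Lemma monomial_eps I j z : monomial (I + eps j) z = z 0 j * monomial I z.
Proof.
rewrite /monomial; under eq_bigr do rewrite ffunE exprD;
  rewrite big_split /= mulrC.
congr (_ * _); rewrite (bigD1 j) //= ffunE eqxx big1 ?mulr1 // => k /negPf kj.
by rewrite ffunE kj.
Qed.

Lemma sphere_cmul u : torus u -> cmul u @^-1` S = S.
Proof.
move=> tu; apply/seteqP; split=> z; rewrite /sphere /= => <-;
  apply: eq_bigr => j _.
  by rewrite mxE normrM tu mul1r.
by rewrite mxE normrM tu mul1r.
Qed.

End SphereFunctions.
(** * Integrals of monomials for a Reinhardt measure *)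

Section ReinhardtIntegrals.
Variables (R : realType) (d : nat) (mu : probability (borelC R d) R).
Local Notation C := R[i].
Local Notation Cvec := 'rV[C^o]_d.
Local Notation S := (@sphere R d).
Implicit Types (I J : multi_index d) (z u : Cvec).

Hypothesis mu_reinhardt : reinhardt mu.

Lemma mu_sphere_lty : (mu S < +oo)%E.
Proof. exact: le_lt_trans (probability_le1 mu (@measurable_sphere R d)) (ltry
  _). Qed.

Lemma Rintegral_cmul u (g : borelC R d -> R) (B : R) : torus u ->
  measurable_fun setT g -> (forall z, S z -> `|g z| <= B) ->
  Rintegral mu S (fun z => g (cmul u z)) = Rintegral mu S g.
Proof.
move=> tu mg gB; congr fine.
have mc := measurable_cmul u.
transitivity (\int[pushforward mu (cmul u : borelC R d -> borelC R d)]_(z in S)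
  (g z)%:E)%E.
  rewrite integral_pushforward //.
  - by rewrite sphere_cmul.
  - exact/measurable_EFinP.
  - rewrite sphere_cmul //.
    apply: (bounded_integrable (@measurable_sphere R d) mu_sphere_lty (B := B)).
      exact: (measurableT_comp mg mc).
    by move=> z Sz; apply: gB; have := sphere_cmul tu;
      move/seteqP => -[_ /(_ _ Sz)].
  - exact: measurable_sphere.
apply: eq_measure_integral => A mA _.
exact: mu_reinhardt.2.
Qed.

(** The push-forward of a Reinhardt measure by an element of the torus is the
    measure itself. *)
Lemma Cint_cmul u (F : borelC R d -> C) : torus u -> bounded_measurable S F ->
  Cint mu S (fun z => F (cmul u z)) = Cint mu S F.
Proof.
move=> tu [mr mi [B hB]]; congr Complex.
  apply: (Rintegral_cmul (B := B) tu mr) => z /hB h.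
  by rewrite -lecR; exact: le_trans (normc_ge_Re _) h.
apply: (Rintegral_cmul (B := B) tu mi) => z /hB h.
by rewrite -lecR; exact: le_trans (normc_ge_Im _) h.
Qed.

Lemma de_Moivre (a : R) n : (cos a +i* sin a) ^+ n = cos (a *+ n) +i* sin (a *+
  n).
Proof.
elim: n => [|n IH]; first by rewrite expr0 mulr0n cos0 sin0.
rewrite exprS IH -[LHS]/((_ - _) +i* (_ + _)) mulrS cosD sinD.
by congr (_ +i* _); rewrite addrC [cos a * _]mulrC.
Qed.

Lemma unit_root_N1 n : (0 < n)%N -> exists2 w : C, `|w| = 1 & w ^+ n = -1.
Proof.
move=> n0; exists (cos (pi / n%:R) +i* sin (pi / n%:R)).
  by rewrite normc_def /= cos2Dsin2 sqrtr1.
rewrite de_Moivre -[pi / _ *+ n]mulr_natr divfK ?pnatr_eq0 -?lt0n // cospi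
  sinpi.
by apply/eqP; rewrite eq_complex /= oppr0 !eqxx.
Qed.

(** Rotate one coordinate on which the exponents differ by a root of [-1]. *)
Lemma monomial_separating I J : I != J ->
  exists2 u : Cvec, torus u & monomial I u * conjC (monomial J u) = -1.
Proof.
move=> IJ.
have [j hj] : exists j, I j != J j.
  apply/existsP; apply: contraNT IJ; rewrite negb_exists => /forallP h.
  by apply/eqP/ffunP => j; apply/eqP; have := h j; rewrite negbK.
have n0 : (0 < maxn (I j) (J j) - minn (I j) (J j))%N.
  by case: (ssrnat.ltngtP (I j) (J j)) hj => // lt _; rewrite subn_gt0.
have [w w1 wn] := unit_root_N1 n0.
pose u : Cvec := \row_k (if k == j then w else 1 : C).
have monE K : monomial K u = w ^+ K j.
  rewrite /monomial (bigD1 j) //= big1 ?mulr1; first by rewrite mxE eqxx.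
  by move=> k /negPf kj; rewrite mxE kj expr1n.
exists u; first by move=> k; rewrite mxE; case: ifP => // _; rewrite normr1.
rewrite !monE rmorphXn /=.
have ww : w * conjC w = 1 by rewrite -normCK w1 expr1n.
have wwn n : w ^+ n * conjC w ^+ n = 1 by rewrite -exprMn ww expr1n.
case: (ssrnat.ltngtP (I j) (J j)) hj n0 wn => // lt _ _ wn.
  rewrite -{1}(subnK (ltnW lt)) exprD mulrCA wwn mulr1 -rmorphXn wn.
  by rewrite rmorphN1.
by rewrite -{1}(subnK (ltnW lt)) exprD -mulrA wwn mulr1.
Qed.

Lemma bounded_measurable_monomial2 I J : bounded_measurable S
  (fun z : borelC R d => monomial I z * conjC (monomial J z)).
Proof.
apply: bounded_measurableM; first exact: bounded_measurable_monomial.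
by apply: bounded_measurable_conj; exact: bounded_measurable_monomial.
Qed.

(** For [u] in the torus with [u^I * (u^J)^* = -1], the change of variables
    [z |-> u z] changes the sign of the integral. *)
Lemma monomial_orthogonal I J : I != J ->
  Cint mu S (fun z => monomial I z * conjC (monomial J z)) = 0.
Proof.
move=> /monomial_separating[u tu h]; set c := Cint _ _ _.
have bm := bounded_measurable_monomial2 I J.
have : c = - c.
  rewrite {1}/c -(Cint_cmul tu bm) -mulN1r -CintZ //; last 2 first.
  - exact: measurable_sphere.
  - exact: mu_sphere_lty.
  by apply: eq_Cint => z _; rewrite !monomial_cmul rmorphM /= -h; ring.
move/eqP; rewrite -subr_eq0 opprK -mulr2n mulrn_eq0 /= => /eqP; exact.
Qed.

Lemma Lnorm2_monomial I (b : R) :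
  'N[mu]_2%:E[(fun z : borelC R d => (normc (monomial I z))%:E)]%E = b%:E ->
  Cint mu S (fun z => monomial I z * conjC (monomial I z)) = (b ^+ 2)%:C.
Proof.
move=> hb; have b0 : 0 <= b by rewrite -lee_fin -hb Lnorm_ge0.
have := powR_Lnorm mu (fun z : borelC R d => (normc (monomial I z))%:E)
  (lt0r_neq0 (ltr0Sn R 1)).
rewrite hb poweR_EFin powR_mulrn //.
rewrite (eq_integral (fun z : borelC R d => ((normc (monomial I z)) ^+ 2)%:E));
  last first.
  move=> z _; rewrite -[LHS]/((`|normc (monomial I z)| `^ 2)%:E).
  by rewrite powR_mulrn ?normr_ge0 // real_normK ?num_real.
have [mr mi _] := bounded_measurable_monomial R I.
have nE z : (normc (monomial I z)) ^+ 2 =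
    Re (monomial I z : C) ^+ 2 + Im (monomial I z : C) ^+ 2.
  by case: (monomial I z) => x y /=; rewrite sqr_sqrtr // addr_ge0 // sqr_ge0.
have mn : measurable_fun setT (fun z : borelC R d => (normc (monomial I z)) ^+
  2).
  under eq_fun do rewrite nE.
  by apply: measurable_funD; exact: measurable_funX.
rewrite (@ge0_negligible_integral _ _ _ mu setT (~` S)) //; last 4 first.
- by apply: measurableC; exact: (@measurable_sphere R d).
- exact/measurable_EFinP.
- by move=> z _; rewrite lee_fin sqr_ge0.
- exact: mu_reinhardt.1.
rewrite setTD setCK => hint.
apply/eqP; rewrite eq_complex /=; apply/andP; split; apply/eqP.
  rewrite -[RHS]/(fine (b ^+ 2)%:E) hint; congr fine; apply: eq_integral => z _.
  by congr EFin; rewrite nE conjcE; case: (monomial I z) => x y /=;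
    rewrite mulrN opprK !expr2.
rewrite /Rintegral integral0_eq // => z _; congr EFin.
by rewrite conjcE; case: (monomial I z) => x y /=; rewrite mulrN mulrC addNr.
Qed.

End ReinhardtIntegrals.
(** * Integration on the product with an interval *)

Section ProductIntegral.
Variables (R : realType) (dX : measure_display) (X : measurableType dX).
Variables (mu : {finite_measure set X -> \bar R}) (S : set X).
Hypothesis mS : measurable S.
Local Notation C := R[i].
Local Notation seg t := (`[0%R, t]%classic : set R).
Local Notation leb := (@lebesgue_measure R).

Definition cylinder : set (X * measurableTypeR R) := S `*` `[0, 1]%classic.
Definition cylinder_measure : {measure set (X * measurableTypeR R) -> \bar R} :=
  (mu \x leb)%E.

Lemma measurable_cylinder : measurable cylinder.
Proof. by apply: measurableX => //; exact: measurable_itv. Qed.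

Lemma cylinder_lty : (cylinder_measure cylinder < +oo)%E.
Proof.
have -> : cylinder_measure cylinder = (mu S * leb (seg 1%R))%E.
  by apply: product_measure1E => //; exact: measurable_itv.
rewrite lebesgue_measure_itv /= lte_fin ltr01 oppr0 adde0 mule1.
by rewrite ltey_eq fin_num_measure.
Qed.

Definition seg_indicator (t : R) (x : X * measurableTypeR R) : C :=
  (\1_(seg t) x.2)%:C.

Lemma measurable_seg t :
  measurable_fun setT (fun x : X * measurableTypeR R => \1_(seg t) x.2 : R).
Proof.
have mi : measurable_fun setT (\1_(seg t) : measurableTypeR R -> R).
  by apply: measurable_indic; exact: measurable_itv.
exact: (measurableT_comp mi measurable_snd).
Qed.

Lemma bounded_measurable_seg_indicator t : bounded_measurable cylinder
  (seg_indicator t).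
Proof.
split.
- exact: measurable_seg.
- exact: measurable_cst.
exists 1 => x _; rewrite /seg_indicator normc_def /= expr0n addr0 sqrtr_sqr
  lecR.
by rewrite indicE; case: (_ \in _); rewrite ?normr1 ?normr0.
Qed.

Lemma bounded_measurable_fst (F : X -> C) : bounded_measurable S F ->
  bounded_measurable cylinder (fun x => F x.1).
Proof.
move=> [mr mi [B hB]]; split.
- exact: (measurableT_comp mr measurable_fst).
- exact: (measurableT_comp mi measurable_fst).
by exists B => x [Sx _]; exact: hB.
Qed.

(** Fubini, the indicator of a segment [0, t] of [0, 1] having integral [t]. *)
Lemma Rintegral_cylinder (g : X -> R) (B t : R) : 0 <= t <= 1 ->
  measurable_fun setT g -> (forall x, S x -> `|g x| <= B) ->
  Rintegral cylinder_measure cylinder (fun x => g x.1 * \1_(seg t) x.2)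
  = t * Rintegral mu S g.
Proof.
move=> /andP[t0 t1] mg gB.
have ind01 (y : R) : `|\1_(seg t) y : R| <= 1.
  by rewrite indicE; case: (_ \in _); rewrite ?normr1 ?normr0.
pose h (x : X * measurableTypeR R) := g x.1 * \1_(seg t) x.2.
have mh : measurable_fun setT h.
  apply: measurable_funM; first exact: (measurableT_comp mg measurable_fst).
  exact: measurable_seg.
have ih : cylinder_measure.-integrable cylinder (EFin \o h).
  apply: (bounded_integrable measurable_cylinder cylinder_lty (B := B) mh).
  move=> x [Sx _]; rewrite normrM -[leRHS]mulr1 ler_pM // gB //.
pose gS := g \_ S.
have hE : (EFin \o h) \_ cylinder =
    (fun x => (gS x.1 * \1_(seg t) x.2)%:E).
  apply/funext => -[x y]; rewrite /gS !patchE /h /= indicE.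
  have [Sx|Sx] := boolP (x \in S); last first.
    rewrite mul0r; case: ifPn => // /set_mem[/= Sx' _].
    by rewrite mem_set in Sx.
  case: ifPn => // /negP yn; have [yt|] := boolP (y \in seg t);
    last by rewrite mulr0.
  exfalso; apply: yn; apply/mem_set; split => /=; first exact: set_mem Sx.
  move/set_mem: yt; rewrite /= !in_itv /= => /andP[-> yt].
  exact: le_trans yt t1.
have ih' : cylinder_measure.-integrable setT
    (fun x => (gS x.1 * \1_(seg t) x.2)%:E).
  by rewrite -hE; exact: (integrable_mkcond _ measurable_cylinder).1 ih.
rewrite /Rintegral integral_mkcond hE -[LHS]/(fine (integral (mu \x leb)%E _
  _)).
rewrite -integral12_prod_meas1 //.
have ig : mu.-integrable S (EFin \o g).
  by apply: (bounded_integrable mS _ (B := B) mg) => //;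
    rewrite ltey_eq fin_num_measure.
have lebt : leb (seg t) = t%:E.
  rewrite lebesgue_measure_itv /= lte_fin oppr0 adde0.
  by case: ltgtP t0 => // <-.
have -> : fubini_F leb (fun x => (gS x.1 * \1_(seg t) x.2)%:E)
    = (fun x => t%:E * (gS x)%:E)%E.
  apply/funext => x; rewrite /fubini_F /=.
  under eq_integral do rewrite EFinM.
  rewrite integralZl //; last exact: (@integrable_indic_itv R 0 t true false).
  rewrite integral_indic ?setIT // muleC; congr (_ * _)%E; exact: lebt.
rewrite integralZl //; last first.
  by have := (integrable_mkcond _ mS).1 ig; rewrite restrict_EFin.
rewrite -[X in integral mu _ X](restrict_EFin g S) -integral_mkcond fineM //.
exact: integrable_fin_num.
Qed.
Lemma Cint_cylinder (F : X -> C) (t : R) : 0 <= t <= 1 -> bounded_measurable S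
  F ->
  Cint cylinder_measure cylinder (fun x => F x.1 * seg_indicator t x) = t%:C *
    Cint mu S F.
Proof.
move=> t01 [mr mi [B hB]].
have nr x : S x -> `|Re (F x)| <= B.
  by move=> /hB h; rewrite -lecR; exact: le_trans (normc_ge_Re _) h.
have ni x : S x -> `|Im (F x)| <= B.
  by move=> /hB h; rewrite -lecR; exact: le_trans (normc_ge_Im _) h.
rewrite {2}/Cint -[RHS]/((_ - _) +i* (_ + _)) !mul0r subr0 addr0.
rewrite -(Rintegral_cylinder t01 mr nr) -(Rintegral_cylinder t01 mi ni).
congr Complex; apply: eq_Rintegral => x _; rewrite /seg_indicator.
  by case: (F x.1) => a b /=; rewrite mulr0 subr0.
by case: (F x.1) => a b /=; rewrite mulr0 add0r.
Qed.

Lemma seg_indicatorM s t x : seg_indicator s x * seg_indicator t x =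
  seg_indicator (Num.min s t) x.
Proof.
rewrite /seg_indicator -rmorphM; congr (_%:C);
  rewrite -[LHS]/((\1_(seg s) \* \1_(seg t)) x.2).
rewrite -indicI; congr (\1_ _ _); apply/seteqP; split => y;
  rewrite /= !in_itv /= le_min.
  by move=> [/andP[-> ->] /andP[_ ->]].
by move=> /andP[-> /andP[-> ->]].
Qed.

End ProductIntegral.
(** * Powers of a weighted shift *)

Section ShiftOrbits.
Variables (R : realType) (d : nat) (H : hilbertType R).
Variables (T : 'I_d -> {linear H -> H}).
Local Notation C := R[i].

(** [tuple_pow] composes the powers of the [T j] in a fixed order, so that one
    more factor [T j] has to be commuted to its place. *)
Lemma tuple_pow_eps I j x : commuting_tuple T ->
  tuple_pow T (I + eps j) x = T j (tuple_pow T I x).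
Proof.
move=> cT; rewrite /tuple_pow.
pose F K r := \big[(fun f g : H -> H => f \o g)/idfun]_(k <- r) iter (K k) (T
  k).
suff main r : uniq r ->
    F (I + eps j) r x = if j \in r then T j (F I r x) else F I r x.
  by have := main (index_enum 'I_d) (index_enum_uniq _); rewrite mem_index_enum.
have itC n i y : T j (iter n (T i) y) = iter n (T i) (T j y).
  by elim: n => //= n <-; exact: cT.
elim: r => [|i r IH /= /andP[ir ur]]; first by rewrite /F !big_nil.
rewrite /F !big_cons /= -!/(F _ _) in_cons.
have -> : (I + eps j) i = (I i + (j == i))%N by rewrite !ffunE eq_sym.
have [ji|ji] /= := eqVneq j i; first by rewrite addn1 /= IH // ji (negPf ir).
by rewrite addn0 IH //; case: ifP => // _; rewrite itC.
Qed.

Variables (e : multi_index d -> H) (w : multi_index d -> 'I_d -> C).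
Hypothesis eo : forall I J, hdot (e I) (e J) = (I == J)%:R.
Hypothesis Te : forall I j, T j (e I) = w I j *: e (I + eps j).
Hypothesis cT : commuting_tuple T.

Definition orbit_coef I : C := hdot (tuple_pow T I (e 0)) (e I).

Lemma tuple_pow_e0 I : tuple_pow T I (e 0) = orbit_coef I *: e I.
Proof.
pose Q J x := exists a : C, x = a *: e J.
have [||a] := @tuple_pow_orbit R d H T Q _ I 0 (e 0).
- move=> J j _ [a ->]; exists (a * w J j).
  by rewrite linearZ /= Te scalerA.
- by exists 1; rewrite scale1r.
by rewrite addr0 /orbit_coef => ->; rewrite hdotZl eo eqxx mulr1.
Qed.

Lemma norm_e I : `|e I| = 1.
Proof. by apply/eqP; rewrite -(@eqrXn2 _ 2) // hdot_norm eo eqxx expr1n. Qed.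

Lemma norm_orbit_coef I : `|orbit_coef I| = (shift_beta e T I)%:C.
Proof.
by rewrite /shift_beta tuple_pow_e0 normrZ norm_e mulr1 RRe_real // normr_real.
Qed.

Hypothesis beta_gt0 : forall I, 0 < shift_beta e T I.

Lemma orbit_coef_neq0 I : orbit_coef I != 0.
Proof. by rewrite -normr_gt0 norm_orbit_coef ltcR beta_gt0. Qed.

Lemma orbit_coef_eps I j : orbit_coef (I + eps j) = orbit_coef I * w I j.
Proof.
rewrite {1}/orbit_coef tuple_pow_eps // tuple_pow_e0 linearZ /= Te scalerA.
by rewrite hdotZl eo eqxx mulr1.
Qed.

Lemma tuple_pow_e I J : tuple_pow T I (e J) = (orbit_coef (I + J) / orbit_coef
  J) *: e (I + J).
Proof.
apply: (@tuple_pow_orbit R d H T (fun K x => x = (orbit_coef K / orbit_coef J)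
  *: e K)).
  by move=> K j _ ->; rewrite linearZ /= Te scalerA orbit_coef_eps mulrAC.
by rewrite divff ?orbit_coef_neq0 // scale1r.
Qed.

(** The contraction inequality tested on [e I], where [|w I j|] is the ratio of
    the values of [beta] at [I + eps j] and [I]. *)
Lemma contraction_weights I : spherical_contraction T ->
  \sum_j shift_beta e T (I + eps j) ^+ 2 <= shift_beta e T I ^+ 2.
Proof.
move=> [_ [S adj le1]]; have := le1 (e I).
rewrite hdot_suml [leRHS]eo eqxx.
rewrite (eq_bigr (fun j => (shift_beta e T (I + eps j) ^+ 2 / shift_beta e T I
  ^+ 2)%:C)).
  rewrite -rmorph_sum -mulr_suml /= lecR ler_pdivrMr ?exprn_gt0 // mul1r; exact.
move=> j _; rewrite hdot_sym -adj -hdot_norm Te normrZ norm_e mulr1.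
rewrite [RHS]rmorphM fmorphV ![in RHS]rmorphXn /= -!norm_orbit_coef
  orbit_coef_eps normrM exprMn.
rewrite mulrC mulKf; last by rewrite expf_eq0 /= normr_eq0 orbit_coef_neq0.
by rewrite conj_Creal // rpredX // normr_real.
Qed.

End ShiftOrbits.
(** * The dilation of a balanced contraction *)

Section CylinderMonomials.
Variables (R : realType) (d : nat) (mu : probability (borelC R d) R).
Local Notation C := R[i].
Local Notation S := (@sphere R d).
Local Notation D := (cylinder S).
Local Notation M := (cylinder_measure mu).
Implicit Types (I J K L : multi_index d).

Lemma bounded_measurable_cylinder_monomial (a : C) (t : R) K :
  bounded_measurable D (fun x => a * (monomial K x.1 * seg_indicator t x)).
Proof.
apply: (bounded_measurableM (bounded_measurable_cst D a)).
apply: bounded_measurableM; last exact: bounded_measurable_seg_indicator.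
exact: (bounded_measurable_fst (bounded_measurable_monomial R K)).
Qed.

Definition cylinder_monomial (a : C) (t : R) K : bfun R D :=
  mkbfun (bounded_measurable_cylinder_monomial a t K).

Lemma cylinder_monomial_dot (a b : C) (s t : R) K L :
  0 <= s <= 1 -> 0 <= t <= 1 ->
  bdot M (cylinder_monomial a s K) (cylinder_monomial b t L) =
  a * conjC b * (Num.min s t)%:C *
    Cint mu S (fun z => monomial K z * conjC (monomial L z)).
Proof.
move=> s01 t01.
have mS := @measurable_sphere R d.
have st01 : 0 <= Num.min s t <= 1 by rewrite /Num.min; case: ifP.
rewrite -mulrA -(Cint_cylinder mu mS st01 (bounded_measurable_monomial2 R K L)).
have bKL := bounded_measurable_fst (bounded_measurable_monomial2 R K L).
rewrite -CintZ; last 3 first.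
- exact: measurable_cylinder.
- exact: cylinder_lty.
- exact: (bounded_measurableM bKL (bounded_measurable_seg_indicator _ _)).
apply: eq_Cint => x _; rewrite -seg_indicatorM /= !rmorphM /=.
have -> : conjC (seg_indicator t x) = seg_indicator t x by exact: conjc_real.
ring.
Qed.

Fact coordinate_le1 j (x : borelC R d * measurableTypeR R) : D x -> `|x.1 0 j :
  C| <= 1.
Proof. by move=> [Sx _]; exact: norm_coord_sphere. Qed.

Definition coordinate_mul (j : 'I_d) :
  dot_contraction (bsemidot (measurable_cylinder (@measurable_sphere R d))
    (cylinder_lty mu (@measurable_sphere R d))) :=
  mul_contraction _ _ (bounded_measurable_fst (bounded_measurable_coord R j))
    (coordinate_le1 j).

End CylinderMonomials.

Lemma mi_deg_eps d (I : multi_index d) (j : 'I_d) : mi_deg (I + eps j) =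
  (mi_deg I).+1.
Proof.
rewrite /mi_deg; under eq_bigr do rewrite ffunE.
rewrite big_split /= -addn1; congr (_ + _)%N.
rewrite (bigD1 j) //= ffunE eqxx big1 // => k /negPf kj.
by rewrite ffunE kj.
Qed.

Section BalancedWeights.
Variables (R : realType) (d : nat) (mu : probability (borelC R d) R).
Variables (beta : multi_index d -> R) (gamma : nat -> R).
Local Notation C := R[i].
Local Notation S := (@sphere R d).
Hypothesis sr : slice_representation beta mu gamma.

Lemma monomial_sqnorm I :
  Cint mu S (fun z => monomial I z * conjC (monomial I z)) =
  ((beta I / gamma (mi_deg I)) ^+ 2)%:C.
Proof.
have [mu_r g0 bE _] := sr; apply: Lnorm2_monomial => //.
have := bE I; have := Lnorm_ge0 mu 2%:E (fun z : borelC R d => (normc (monomial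
  I z))%:E).
case: ('N[mu]_2%:E[_])%E => [r _|_|//].
  by move=> [->]; rewrite mulrAC divff ?mul1r // gt_eqF.
by rewrite gt0_muley ?lte_fin.
Qed.

(** Integrate [\sum_j |z_j|^2 = 1] against [|z^I|^2]. *)
Lemma monomial_sqnorm_sum I :
  \sum_j (beta (I + eps j) / gamma (mi_deg I).+1) ^+ 2 =
  (beta I / gamma (mi_deg I)) ^+ 2.
Proof.
apply: complexI; rewrite rmorph_sum /= -monomial_sqnorm.
pose f K := mkbfun (bounded_measurable_monomial R K) : bfun R S.
have := @bdot_sum _ _ _ S mu (@measurable_sphere R d) (mu_sphere_lty mu)
  _ (index_enum 'I_d) (fun j => f (I + eps j)) (fun j => f (I + eps j)) (f I)
    (f I).
rewrite /bdot /= => <-.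
  apply: eq_bigr => j _; rewrite -(mi_deg_eps I j);
    exact: esym (monomial_sqnorm _).
move=> z Sz; rewrite -[RHS]mul1r -{1}Sz mulr_suml; apply: eq_bigr => j _.
rewrite monomial_eps normCK rmorphM /=; ring.
Qed.

(** Compare, at a multi-index [I] of degree [k], the identity
    [monomial_sqnorm_sum] with the contraction inequality for [beta]. *)
Lemma gamma_noninc (j0 : 'I_d) : (forall I, 0 < beta I) ->
  (forall I, \sum_j beta (I + eps j) ^+ 2 <= beta I ^+ 2) ->
  {homo gamma : m n / (m <= n)%N >-> n <= m}.
Proof.
move=> b0 bsum; have [_ g0 _ _] := sr.
apply/nonincreasing_seqP => k.
pose I : multi_index d := eps j0 *+ k.
have Ik : mi_deg I = k.
  rewrite /I; elim: k {I} => [|k IH]; last by rewrite mulrSr mi_deg_eps IH.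
  by rewrite mulr0n /mi_deg big1 // => j _; rewrite ffunE.
have := monomial_sqnorm_sum I; have := bsum I; rewrite Ik => h.
under eq_bigr do rewrite exprMn; rewrite -mulr_suml exprMn => e.
rewrite -(@ler_pXn2r _ 2) ?nnegrE ?(ltW (g0 _)) //.
have gk : gamma k != 0 by rewrite gt_eqF.
have gk1 : gamma k.+1 != 0 by rewrite gt_eqF.
have e2 : gamma k.+1 ^+ 2 * beta I ^+ 2 =
    gamma k ^+ 2 * \sum_j beta (I + eps j) ^+ 2.
  have e' : beta I ^+ 2 = (\sum_j beta (I + eps j) ^+ 2) * (gamma k.+1)^-1 ^+ 2
    * gamma k ^+ 2.
    by rewrite e -mulrA -exprMn mulVf // expr1n mulr1.
  rewrite {1}e'; field; exact: gk1.
rewrite -(@ler_pM2r _ (beta I ^+ 2)) ?exprn_gt0 // e2 ler_pM2l ?exprn_gt0 //.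
Qed.

End BalancedWeights.

Theorem corollary1 (R : realType) (d : nat) (d_gt0 : (0 < d)%N)
    (H : hilbertType R) (e : multi_index d -> H)
    (w : multi_index d -> 'I_d -> R[i]) (T : 'I_d -> {linear H -> H}) :
  weighted_shift e w T ->
  spherical_contraction T ->
  balanced e T ->
  admits_spherical_dilation T.
Proof.
move=> [be _ bT Te] sc [b0 [mu [gamma sr]]].
have [eo cT] := (be.1, sc.1).
have [mu_r g0 _ _] := sr.
have ginc := gamma_noninc sr (Ordinal d_gt0) b0 (fun I => contraction_weights
  eo Te cT b0 I sc).
pose W := orbit_coef T e.
have W0 I : W I != 0 by exact: (orbit_coef_neq0 eo Te).
(* Dividing by [gamma 0 ^+ 2] keeps the intervals [[0, t k]] inside [[0, 1]];
   the numerator of [a J] compensates for it. *)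
pose t k : R := gamma k ^+ 2 / gamma 0 ^+ 2.
have t01 k : 0 <= t k <= 1.
  rewrite divr_ge0 ?sqr_ge0 //= ler_pdivrMr ?exprn_gt0 // mul1r.
  by rewrite ler_pXn2r ?nnegrE ?(ltW (g0 _)) // ginc.
pose a J : R[i] := (gamma 0)%:C / W J.
pose q := bsemidot (measurable_cylinder (@measurable_sphere R d))
  (cylinder_lty mu (@measurable_sphere R d)).
pose f J : completion q := embed q (cylinder_monomial (a J) (t (mi_deg J)) J).
have min_t J L : (mi_deg J <= mi_deg L)%N ->
    Num.min (t (mi_deg J)) (t (mi_deg L)) = t (mi_deg L).
  move=> JL; apply/min_idPr; rewrite ler_pM2r ?invr_gt0 ?exprn_gt0 //.
  by rewrite ler_pXn2r ?nnegrE ?(ltW (g0 _)) // ginc.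
have bW L : (shift_beta e T L)%:C ^+ 2 = W L * conjC (W L).
  by rewrite -normCK (norm_orbit_coef eo Te).
have dotE J K L : (K == L -> (mi_deg J <= mi_deg L)%N) ->
    hdot (embed q (cylinder_monomial (a J) (t (mi_deg J)) K)) (f L) =
    (K == L)%:R * (W L / W J).
  move=> JL; rewrite completion_hdotE cdot_embed.
  rewrite -[LHS]/(bdot _ _ _) cylinder_monomial_dot //.
  have [KL|KL] := eqVneq K L; last by rewrite monomial_orthogonal // mulr0
    mul0r.
  rewrite KL (monomial_sqnorm sr) mul1r min_t ?JL ?KL //.
  have g00 : (gamma 0)%:C != 0 by rewrite gt_eqF // ltcR.
  have gL0 : (gamma (mi_deg L))%:C != 0 by rewrite gt_eqF // ltcR.
  have WL0 : conjC (W L) != 0 by rewrite conjC_eq0.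
  have aLE : conjC (a L) = (gamma 0)%:C / conjC (W L).
    by rewrite /a rmorphM fmorphV; congr (_ / _); exact: conjc_real.
  have tE : (t (mi_deg L))%:C = (gamma (mi_deg L))%:C ^+ 2 / (gamma 0)%:C ^+ 2.
    by rewrite rmorphM fmorphV !rmorphXn.
  have nE : ((shift_beta e T L / gamma (mi_deg L)) ^+ 2)%:C =
      W L * conjC (W L) / (gamma (mi_deg L))%:C ^+ 2.
    by rewrite expr_div_n rmorphM fmorphV !rmorphXn bW.
  rewrite aLE tE nE /a; field.
  by rewrite g00 gL0 WL0 W0.
have fo J L : hdot (f J) (f L) = (J == L)%:R.
  rewrite dotE => [|/eqP ->//].
  by have [->|] := eqVneq J L; [rewrite divff // mulr1|rewrite mul0r].
apply: (@spherical_dilation_criterion _ _ H (completion q) e f T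
  (fun j => extend (coordinate_mul mu j)) be fo bT).
  apply: mul_spherical_unitary => x [Sx _]; exact: Sx.
move=> I J L; rewrite (tuple_pow_e eo Te cT b0) hdotZl eo.
have -> : tuple_pow (fun j => extend (coordinate_mul mu j)) I (f J) =
    embed q (cylinder_monomial (a J) (t (mi_deg J)) (I + J)).
  apply: (@tuple_pow_orbit R d (completion q) (fun j => extend (coordinate_mul
    mu j))
    (fun K x => x = embed q (cylinder_monomial (a J) (t (mi_deg J)) K))) => //.
  move=> K j _ ->; rewrite -[LHS]/(extend (coordinate_mul mu j) (embed q _)).
  rewrite extend_embed; congr embed; apply: bfun_ext => x /=.
  by rewrite monomial_eps mulrCA !mulrA.
(* When the scalar product is nonzero, [L = I + J] has at least the degree of [J],
   so the smaller of the two intervals is that of [L]. *)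
rewrite dotE => [|/eqP <-]; last first.
  by rewrite /mi_deg leq_sum // => j _; rewrite ffunE leq_addl.
by have [->|] := eqVneq (I + J) L; rewrite ?mul1r ?mulr1 // mul0r mulr0.
Qed.
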